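(* There is an associative product $\#$ in the space $\Lambda$ of symmetric functions, interpolating between the internal and external products, which can be expressed in the basis $(h_\alpha)$ of complete homogeneous functions as $$h_\alpha\#h_\beta=\sum_{n=\max(p,q)}^{p+q}\ \sum_{M\in\mathcal M^n_{\alpha,\beta}}h_{p(M)}$$ for all compositions $\alpha$ of $p$ and $\beta$ of $q$.
   Context: Let $\Bbbk$ be a field of characteristic zero and $\Lambda=\bigoplus_{n\ge0}\Lambda_n$ the graded space of symmetric functions over $\Bbbk$ in countably many variables. For $a\ge1$, $h_a$ is the complete homogeneous symmetric function of degree $a$; for a composition (finite sequence of positive integers) or partition $\alpha=(a_1,\dots,a_r)$, $h_\alpha=h_{a_1}\cdots h_{a_r}$ (independent of the order of the parts; $h_{()}=1$). External product: the ordinary multiplication of symmetric functions. Internal product $*$: the product on each $\Lambda_n$ corresponding, under the Frobenius characteristic, to the Kronecker (tensor) product of representations of $S_n$; in power sums $p_\lambda*p_\mu=\delta_{\lambda,\mu}z_\lambda p_\lambda$ with $z_\lambda=\prod_r r^{m_r}m_r!$, $m_r$ the number of parts of $\lambda$ equal to $r$. ''Interpolating'' means: for $f\in\Lambda_p$, $g\in\Lambda_q$ one has $f\#g\in\bigoplus_{n=\max(p,q)}^{p+q}\Lambda_n$, its component in degree $p+q$ is the external product $fg$, and, if $p=q$, its component in degree $p$ is the internal product $f*g$. For compositions $\alpha=(a_1,\dots,a_r)$ of $p$, $\beta=(b_1,\dots,b_s)$ of $q$ and $\max(p,q)\le n\le p+q$, $\mathcal M^n_{\alpha,\beta}$ is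 the set of $(s+1)\times(r+1)$ matrices $M=(m_{ij})_{0\le i\le s,\,0\le j\le r}$ with non-negative integer entries such that $m_{00}=0$, the sequence of column sums (columns $0,1,\dots,r$) is $(n-p,a_1,\dots,a_r)$, and the sequence of row sums (rows $0,1,\dots,s$) is $(n-q,b_1,\dots,b_s)$. $p(M)$ is the partition of $n$ whose parts are the non-zero entries $m_{ij}$ of $M$. *)

(* Defs.v *)
From HB Require Import structures.
From mathcomp Require Import all_boot all_order all_algebra.
From mathcomp Require Import perm boolp.
From mathcomp Require Import mpoly.

Set Implicit Arguments.
Unset Strict Implicit.
Unset Printing Implicit Defensive.

Import GRing.Theory.
Local Open Scope ring_scope.

(* The algebra of symmetric functions in x_0, x_1, ... is realized as the
   limit, in the category of graded algebras, of the algebras of symmetric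
   polynomials in x_0, ..., x_(n-1), along the maps setting the last variable
   to 0. An element is a compatible family of symmetric polynomials of bounded
   degree; its n-th term is its image under x_i := 0 for i >= n. *)

Definition mpoly_family (k : fieldType) := forall n, {mpoly k[n]}.

Section FamilyAlgebra.
Variable k : fieldType.
Local Notation F := (mpoly_family k).
Implicit Types f g h : F.

HB.instance Definition _ := gen_eqMixin F.
HB.instance Definition _ := gen_choiceMixin F.

Local Lemma familyP f g : (forall n, f n = g n) -> f = g.
Proof. exact: functional_extensionality_dep. Qed.

Definition family_add f g : F := fun n => f n + g n.
Definition family_opp f : F := fun n => - f n.
Definition family_mul f g : F := fun n => f n * g n.
Definition family_scale (c : k) f : F := fun n => c *: f n.

Fact family_addA : associative family_add.
Proof. by move=> f g h; apply: familyP => n; apply: addrA. Qed.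
Fact family_addC : commutative family_add.
Proof. by move=> f g; apply: familyP => n; apply: addrC. Qed.
Fact family_add0 : left_id (fun=> 0) family_add.
Proof. by move=> f; apply: familyP => n; apply: add0r. Qed.
Fact family_addN : left_inverse (fun=> 0) family_opp family_add.
Proof. by move=> f; apply: familyP => n; apply: addNr. Qed.
HB.instance Definition _ :=
  GRing.isZmodule.Build F family_addA family_addC family_add0 family_addN.

Fact family_mulA : associative family_mul.
Proof. by move=> f g h; apply: familyP => n; apply: mulrA. Qed.
Fact family_mulC : commutative family_mul.
Proof. by move=> f g; apply: familyP => n; apply: mulrC. Qed.
Fact family_mul1 : left_id (fun=> 1) family_mul.
Proof. by move=> f; apply: familyP => n; apply: mul1r. Qed.
Fact family_mulDl : left_distributive family_mul +%R.
Proof. by move=> f g h; apply: familyP => n; apply: mulrDl. Qed.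
Fact family_oner_neq0 : (fun=> 1 : {mpoly k[_]}) != 0 :> F.
Proof.
by apply/eqP=> /(congr1 (fun f : F => f 0)) /eqP; rewrite (negPf (oner_neq0 _)).
Qed.
HB.instance Definition _ := GRing.Zmodule_isComNzRing.Build F
  family_mulA family_mulC family_mul1 family_mulDl family_oner_neq0.

Fact family_scaleA a b f :
  family_scale a (family_scale b f) = family_scale (a * b) f.
Proof. by apply: familyP => n; apply: scalerA. Qed.
Fact family_scale1 : left_id 1 family_scale.
Proof. by move=> f; apply: familyP => n; apply: scale1r. Qed.
Fact family_scaleDr : right_distributive family_scale +%R.
Proof. by move=> a f g; apply: familyP => n; apply: scalerDr. Qed.
Fact family_scaleDl f : {morph family_scale^~ f : a b / a + b}.
Proof. by move=> a b; apply: familyP => n; apply: scalerDl. Qed.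
HB.instance Definition _ := GRing.Zmodule_isLmodule.Build k F
  family_scaleA family_scale1 family_scaleDr family_scaleDl.

Fact family_scaleAl (a : k) f g : a *: (f * g) = a *: f * g.
Proof. by apply: familyP => n; apply: scalerAl. Qed.
HB.instance Definition _ := GRing.Lmodule_isLalgebra.Build k F family_scaleAl.
HB.instance Definition _ := GRing.Lalgebra_isComAlgebra.Build k F.

End FamilyAlgebra.

Definition last0_vars (k : fieldType) n : n.+1.-tuple {mpoly k[n]} :=
  [tuple (if unlift ord_max i is Some j then 'X_j else 0) | i < n.+1].

Definition set_last0 (k : fieldType) n (p : {mpoly k[n.+1]}) : {mpoly k[n]} :=
  p \mPo last0_vars k n.

Definition is_symfun (k : fieldType) (f : mpoly_family k) : Prop :=
  [/\ forall n, f n \is symmetric,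
      forall n, set_last0 (f n.+1) = f n
    & exists d, forall n, (msize (f n) <= d)%N].

Definition symfun_pred (k : fieldType) : pred (mpoly_family k) :=
  fun f => `[< is_symfun f >].

Record symfun (k : fieldType) :=
  Symfun { symfun_val :> mpoly_family k; _ : symfun_pred symfun_val }.
Arguments Symfun {k}.

Section SymfunAlgebra.
Variable k : fieldType.

HB.instance Definition _ := [isSub for @symfun_val k].
HB.instance Definition _ := [Choice of symfun k by <:].

Fact symfun_subring_closed : subring_closed (@symfun_pred k).
Proof.
split=> [|f g /asboolP[sf rf [d bf]] /asboolP[sg rg [e bg]]|
          f g /asboolP[sf rf [d bf]] /asboolP[sg rg [e bg]]]; apply/asboolP.
- split=> [n|n|]; first exact: rpred1.
    exact: comp_mpoly1.
  by exists 1%N => n; rewrite msize1.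
- split=> [n|n|]; first exact: rpredB (sf n) (sg n).
    by rewrite /set_last0 comp_mpolyB -/(set_last0 _) rf -/(set_last0 _) rg.
  exists (maxn d e) => n; apply: leq_trans (msizeD_le _ _) _.
  by rewrite msizeN geq_max !leq_max bf bg orbT.
- split=> [n|n|]; first exact: rpredM (sf n) (sg n).
    by rewrite /set_last0 rmorphM /= -/(set_last0 _) rf -/(set_last0 _) rg.
  exists (d + e).+1 => n; apply: leq_trans (msizeM_le _ _) _.
  by rewrite ltnS; exact: leq_add.
Qed.

Fact symfun_submod_closed : subsemimod_closed (@symfun_pred k).
Proof.
have [S1 SB _] := symfun_subring_closed; split; first split.
- by rewrite -(subrr 1); apply: SB.
- move=> f g Sf Sg; rewrite -[g]opprK -[- g]sub0r; apply: (SB) => //.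
  by apply: (SB) => //; rewrite -(subrr 1); apply: SB.
- move=> c f /asboolP[sf rf [d bf]]; apply/asboolP; split=> [n|n|].
  + exact: rpredZ (sf n).
  + by rewrite /set_last0 comp_mpolyZ -/(set_last0 _) rf.
  + by exists d => n; apply: leq_trans (msizeZ_le _ _) (bf n).
Qed.

HB.instance Definition _ :=
  GRing.SubChoice_isSubComNzRing.Build _ _ (symfun k) symfun_subring_closed.
HB.instance Definition _ :=
  GRing.SubZmodule_isSubLmodule.Build _ _ _ (symfun k) symfun_submod_closed.
HB.instance Definition _ :=
  GRing.SubNzRing_SubLmodule_isSubLalgebra.Build _ _ _ (symfun k).
HB.instance Definition _ := GRing.Lalgebra_isComAlgebra.Build k (symfun k).

End SymfunAlgebra.

Section Generators.
Variable k : fieldType.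

Lemma widen_lift_max n (i : 'I_n) : widen_ord (leqnSn n) i = lift ord_max i.
Proof. by apply: val_inj; rewrite /= /bump leqNgt ltn_ord. Qed.

Lemma set_last0X n (m : 'X_{1..n.+1}) :
  set_last0 ('X_[k, m]) =
  if m ord_max == 0%N
  then 'X_[[multinom m (widen_ord (leqnSn n) i) | i < n]] else 0.
Proof.
rewrite /set_last0 comp_mpolyX big_ord_recr /= tnth_mktuple unlift_none.
case: eqP => [->|/eqP m0]; last by rewrite expr0n (negPf m0) mulr0.
rewrite expr0 mulr1 [in RHS]mpolyXE_id; apply: eq_bigr => i _.
rewrite tnth_mktuple mnmE; congr (_ ^+ _).
by rewrite widen_lift_max liftK.
Qed.

Lemma mcoeff_set_last0 n (p : {mpoly k[n.+1]}) m :
  (set_last0 p)@_m = p@_(mnmwiden m).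
Proof.
rewrite /set_last0 comp_mpolyEX raddf_sum /=.
rewrite [in RHS](mpolyE p) raddf_sum /=; apply: eq_bigr => m' _.
rewrite -/(set_last0 _) set_last0X !mcoeffZ mcoeffX; congr (_ * _).
case: eqP => [m'0|m'0].
  rewrite mcoeffX; congr (nat_of_bool _)%:R; apply/eqP/eqP => [<-|->].
    apply/mnmP => i; case: (unliftP ord_max i) => [j ->|->].
      by rewrite -widen_lift_max mnmwiden_widen mnmE.
    by rewrite mnmwiden_ordmax.
  by apply/mnmP => i; rewrite mnmE mnmwiden_widen.
rewrite mcoeff0; case: eqP => // m'E; case: m'0.
by rewrite m'E mnmwiden_ordmax.
Qed.

Definition hsym_family a : mpoly_family k :=
  fun n => \sum_(m : 'X_{1..n < a.+1} | mdeg m == a) 'X_[m].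

Lemma mcoeff_hsym a n (m : 'X_{1..n}) :
  (hsym_family a n)@_m = (mdeg m == a)%:R.
Proof.
rewrite /hsym_family raddf_sum /=.
under eq_bigr do rewrite mcoeffX.
case: eqP => [dm|dm].
  have lt_m : (mdeg m < a.+1)%N by rewrite dm.
  rewrite (bigD1 (BMultinom lt_m)) /= ?dm // eqxx big1 ?addr0 // => m'.
  by case/andP=> _; rewrite -val_eqE /= => /negPf ->.
by rewrite big1 // => m' /eqP dm'; case: eqP => // mm'; case: dm; rewrite -mm'.
Qed.

Fact hsym_subproof a : symfun_pred (hsym_family a).
Proof.
apply/asboolP; split=> [n|n|].
- apply/issymP => s; apply/mpolyP => m.
  by rewrite mcoeff_sym !mcoeff_hsym mdeg_mperm.
- apply/mpolyP => m; rewrite mcoeff_set_last0 !mcoeff_hsym; congr (_ == _)%:R.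
  rewrite !mdegE big_ord_recr /= mnmwiden_ordmax addn0.
  by apply: eq_bigr => i _; rewrite mnmwiden_widen.
- exists a.+1 => n; rewrite msizeE; apply/bigmax_leqP_seq => m mP _.
  move: mP; rewrite mcoeff_msupp mcoeff_hsym.
  by case: (eqVneq (mdeg m) a) => [->|] //; rewrite eqxx.
Qed.

Definition hsym a : symfun k := Symfun (hsym_family a) (hsym_subproof a).

(* p_0 := 1 is only a convention making the family compatible; p_0 is never
   a factor of p_lambda. *)
Definition psum_family r : mpoly_family k :=
  fun n => if r is 0 then 1 else \sum_(i < n) 'X_i ^+ r.

Fact psum_subproof r : symfun_pred (psum_family r).
Proof.
apply/asboolP; case: r => [|r]; split=> [n|n|] /=; first exact: rpred1.
- exact: comp_mpoly1.
- by exists 1%N => n; rewrite msize1.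
- apply/issymP => s; rewrite raddf_sum /= [RHS](reindex_inj (@perm_inj _ s)) /=.
  apply: eq_bigr => i _; rewrite rmorphXn /= msymX; congr ('X_[_] ^+ _).
  apply/mnmP => j; rewrite mnmE !mnm1E; congr nat_of_bool.
  by apply/eqP/eqP => [->|<-]; rewrite ?permKV ?permK.
- rewrite /psum_family big_ord_recr /= /set_last0 raddfD /= raddf_sum /=.
  rewrite rmorphXn /= comp_mpolyXU -tnth_nth tnth_mktuple unlift_none expr0n /=.
  rewrite addr0; apply: eq_bigr => i _; rewrite rmorphXn /= comp_mpolyXU.
  rewrite -tnth_nth tnth_mktuple; congr (_ ^+ _).
  by rewrite widen_lift_max liftK.
- exists r.+2 => n; apply: leq_trans (msize_sum _ _ _) _.
  apply/bigmax_leqP => i _; rewrite mpolyXn msizeX mdegMn mdeg1 mul1n //.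
Qed.

Definition psum r : symfun k := Symfun (psum_family r) (psum_subproof r).

End Generators.

Section Products.
Variable k : fieldType.
Local Notation Lambda := (symfun k).

Definition homogeneous (d : nat) (f : Lambda) : Prop :=
  forall n, symfun_val f n \is d.-homog.

Definition is_composition (a : seq nat) : bool := all (leq 1) a.

Definition is_partition (l : seq nat) : bool :=
  sorted geq l && is_composition l.

Definition hsyms (a : seq nat) : Lambda := \prod_(i <- a) hsym k i.

Definition psums (l : seq nat) : Lambda := \prod_(i <- l) psum k i.

Definition zpart (l : seq nat) : nat :=
  (\prod_(r <- undup l) (r ^ count_mem r l * (count_mem r l)`!))%N.

(* The internal product, extended by zero to Lambda_p x Lambda_q for p != q.
   As the psums l form a basis of Lambda in characteristic zero, this
   determines star. *)
Definition is_internal_product (star : Lambda -> Lambda -> Lambda) : Prop :=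
  forall l m : seq nat, is_partition l -> is_partition m ->
    star (psums l) (psums m) = if l == m then (zpart l)%:R *: psums l else 0.

(* c n is the component of sharp f g in Lambda_n. *)
Definition interpolates (star sharp : Lambda -> Lambda -> Lambda) : Prop :=
  forall (p q : nat) (f g : Lambda), homogeneous p f -> homogeneous q g ->
  exists c : nat -> Lambda,
    [/\ forall n, homogeneous n (c n),
        sharp f g = \sum_(maxn p q <= n < (p + q).+1) c n,
        c (p + q)%N = f * g
      & p = q -> c p = star f g].

End Products.

(* The set M^n_(a, b), with rows indexed by 0 .. size b and columns by
   0 .. size a. Taking the entries in 'I_n.+1 is no restriction, since they
   are non-negative with total sum n. The subtractions do not truncate when
   maxn (sumn a) (sumn b) <= n. *)
Definition sharp_matrices (n : nat) (a b : seq nat) :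
    {set 'M['I_n.+1]_((size b).+1, (size a).+1)} :=
  [set M : 'M['I_n.+1]_((size b).+1, (size a).+1) |
    [&& M ord0 ord0 == 0%N :> nat,
        [forall j, \sum_i (M i j : nat) == nth 0 ((n - sumn a) :: a) j]%N
      & [forall i, \sum_j (M i j : nat) == nth 0 ((n - sumn b) :: b) i]%N]].

Definition matrix_partition (n r c : nat) (M : 'M['I_n.+1]_(r, c)) : seq nat :=
  sort geq [seq x <- [seq (M i j : nat) | i <- enum 'I_r, j <- enum 'I_c]
           | x != 0%N].

(* Main.v *)
From HB Require Import structures.
Require Import Defs.
From mathcomp Require Import all_boot all_order all_algebra.
From mathcomp Require Import perm boolp mpoly zify.

(* Write p_r^* for the adjoint of multiplication by p_r for the Hall inner
   product, and e_l(f) = <p_l, f> for the value of f, seen as a class function,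
   on cycle type l. The internal product is determined by
   e_l(f * g) = e_l(f) e_l(g). Let sigma be the sum of all the h_n; on cycle
   type l the class function f sigma takes the value
   Psi_l(f) = <\prod_(r in l) (1 + p_r), f>. In characteristic zero these values
   determine f, and the product # is defined by Psi_l(f # g) = Psi_l(f) Psi_l(g),
   so that its associativity is that of the pointwise product.
   Since 1 + p_r^* sends h_a to h_a + h_(a - r) and p_r^* is a derivation,
   Psi_l(h_a1 ... h_as) counts the distributions of the parts of l among s + 1
   boxes, the contents of all boxes but the first being prescribed. A pair of
   distributions is a distribution among the entries of a matrix, which gives
   the formula in the basis h. On Lambda_p with |l| = p, Psi_l and e_l agree and
   Psi_l vanishes in larger degrees, hence the lowest component of f # g is
   f * g. *)

Set Implicit Arguments.
Unset Strict Implicit.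
Unset Printing Implicit Defensive.

Import Order.TTheory GRing.Theory Num.Theory.
Local Open Scope ring_scope.

(** * Coefficients of symmetric functions when a variable is appended *)

Section Coefficients.
Variable k : fieldType.
Local Notation Lambda := (symfun k).
Implicit Types f g : Lambda.

Lemma symfun_inj f g : (forall n, symfun_val f n = symfun_val g n) -> f = g.
Proof.
by move=> fg; apply: val_inj; apply: functional_extensionality_dep.
Qed.

Lemma symfun_eqP f g :
  (forall n (u : 'X_{1..n}), (symfun_val f n)@_u = (symfun_val g n)@_u) -> f = g.
Proof.
by move=> fg; apply: symfun_inj => n; apply/mpolyP => u; apply: fg.
Qed.

Lemma symfunD f g n : symfun_val (f + g) n = symfun_val f n + symfun_val g n.
Proof. by []. Qed.

Lemma symfunZ (c : k) f n : symfun_val (c *: f) n = c *: symfun_val f n.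
Proof. by []. Qed.

Lemma symfunM f g n : symfun_val (f * g) n = symfun_val f n * symfun_val g n.
Proof. by []. Qed.

Lemma symfun0 n : symfun_val (0 : Lambda) n = 0. Proof. by []. Qed.
Lemma symfun1 n : symfun_val (1 : Lambda) n = 1. Proof. by []. Qed.
Lemma symfun_sum I (r : seq I) (P : pred I) (F : I -> Lambda) n :
  symfun_val (\sum_(i <- r | P i) F i) n = \sum_(i <- r | P i) symfun_val (F i) n.
Proof. by elim/big_rec2: _ => // i x y _ <-. Qed.

Lemma symfun_symm f n : symfun_val f n \is symmetric.
Proof. by case: f => f fP /=; case/asboolP: (fP). Qed.

Lemma symfun_last0 f n : set_last0 (symfun_val f n.+1) = symfun_val f n.
Proof. by case: f => f fP /=; case/asboolP: (fP). Qed.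

Lemma symfun_bounded f : exists d, forall n, (msize (symfun_val f n) <= d)%N.
Proof. by case: f => f fP /=; case/asboolP: (fP). Qed.

Definition mnmrcons n (u : 'X_{1..n}) a : 'X_{1..n.+1} := [multinom of rcons u a].

Lemma mnmrcons_max n (u : 'X_{1..n}) a : mnmrcons u a ord_max = a.
Proof.
by rewrite multinomE (tnth_nth 0%N) nth_rcons /= size_tuple ltnn eqxx.
Qed.

Lemma mnmrcons_widen n (u : 'X_{1..n}) a i :
  mnmrcons u a (widen_ord (leqnSn n) i) = u i.
Proof.
case: u => u; rewrite !(mnm_nth 0%N) nth_rcons size_tuple /=.
by case: i => i /= ->.
Qed.

Lemma mnmrconsP n (v : 'X_{1..n.+1}) : exists u a, v = mnmrcons u a.
Proof.
exists [multinom v (widen_ord (leqnSn n) i) | i < n], (v ord_max).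
apply/mnmP => i; case: (unliftP ord_max i) => [j ->|->].
  by rewrite -widen_lift_max mnmrcons_widen mnmE.
by rewrite mnmrcons_max.
Qed.

Lemma mdeg_rcons n (u : 'X_{1..n}) a : mdeg (mnmrcons u a) = (mdeg u + a)%N.
Proof.
rewrite !mdegE big_ord_recr /= mnmrcons_max; congr (_ + _)%N.
by apply: eq_bigr => i _; rewrite mnmrcons_widen.
Qed.

Lemma eq_mnmrcons n (v : 'X_{1..n.+1}) (u : 'X_{1..n}) a :
  (v == mnmrcons u a) =
  ([multinom v (widen_ord (leqnSn n) i) | i < n] == u) && (v ord_max == a).
Proof.
apply/eqP/andP => [->|[/eqP <- /eqP <-]].
  rewrite mnmrcons_max eqxx; split=> //; apply/eqP/mnmP => i.
  by rewrite mnmE mnmrcons_widen.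
apply/mnmP => i; case: (unliftP ord_max i) => [j ->|->].
  by rewrite -widen_lift_max mnmrcons_widen mnmE.
by rewrite mnmrcons_max.
Qed.

Lemma mcoeff_muni n (p : {mpoly k[n.+1]}) a u :
  (muni p)`_a@_u = p@_(mnmrcons u a).
Proof.
rewrite muniE coef_sum raddf_sum [in RHS](mpolyE p) raddf_sum /=.
apply: eq_bigr => v _; rewrite coefZ coefXn mcoeffZ mcoeffX eq_mnmrcons.
rewrite (eq_sym a); case: (v ord_max == a); last first.
  by rewrite mulr0 mcoeff0 andbF mulr0.
by rewrite mulr1 mcoeffZ mcoeffX andbT eq_sym.
Qed.

Lemma symfun_coef_rcons0 f n (u : 'X_{1..n}) :
  (symfun_val f n.+1)@_(mnmrcons u 0) = (symfun_val f n)@_u.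
Proof.
by rewrite -(symfun_last0 f n) mcoeff_set_last0.
Qed.

(** Invariance under the transposition of the last two variables. It makes [skew_hsym_family]
    compatible with setting the last variable to 0, and it makes the operators [skew_hsym]
    commute. *)
Lemma symfun_coef_swap f n (u : 'X_{1..n}) a b :
  (symfun_val f n.+2)@_(mnmrcons (mnmrcons u a) b) =
  (symfun_val f n.+2)@_(mnmrcons (mnmrcons u b) a).
Proof.
set j : 'I_n.+2 := widen_ord (leqnSn n.+1) ord_max.
rewrite -(msym_coeff _ (tperm j ord_max) (symfun_symm f n.+2)); congr (_@__).
apply/mnmP => i; rewrite mnmE.
have jm : j != ord_max by rewrite -val_eqE /= neq_ltn ltnSn.
case: tpermP => [->|->|/eqP ij /eqP im].
- by rewrite mnmrcons_max /j mnmrcons_widen mnmrcons_max.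
- by rewrite mnmrcons_max /j mnmrcons_widen mnmrcons_max.
case: (unliftP ord_max i) => [i' i'E|im']; last by rewrite im' eqxx in im.
rewrite -widen_lift_max in i'E; rewrite i'E !mnmrcons_widen.
case: (unliftP ord_max i') => [i'' i''E|im'].
  by rewrite -widen_lift_max in i''E; rewrite i''E !mnmrcons_widen.
by rewrite i'E im' eqxx in ij.
Qed.

End Coefficients.

(** * Adjoints of multiplication by the h_a *)

Section SkewHsymFamily.
Variable k : fieldType.
Local Notation Lambda := (symfun k).
Implicit Types f g : Lambda.

Definition skew_hsym_family a (f : Lambda) : mpoly_family k :=
  fun n => (muni (symfun_val f n.+1))`_a.

Lemma mcoeff_skew_hsym_family a f n u :
  (skew_hsym_family a f n)@_u = (symfun_val f n.+1)@_(mnmrcons u a).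
Proof. exact: mcoeff_muni. Qed.

Fact skew_hsym_subproof a f : symfun_pred (skew_hsym_family a f).
Proof.
apply/asboolP; split=> [n|n|].
- apply/issymP => s; apply/mpolyP => u.
  rewrite mcoeff_sym !mcoeff_skew_hsym_family.
  rewrite -[RHS](msym_coeff _ (lift_perm ord_max ord_max s) (symfun_symm f n.+1)).
  congr (_@__); apply/mnmP => i; rewrite mnmE.
  case: (unliftP ord_max i) => [j ->|->].
    by rewrite lift_perm_lift -!(@widen_lift_max n) !mnmrcons_widen mnmE.
  by rewrite lift_perm_id !mnmrcons_max.
- apply/mpolyP => u; rewrite mcoeff_set_last0 !mcoeff_skew_hsym_family.
  rewrite -[RHS]symfun_coef_rcons0 -[mnmwiden u]/(mnmrcons u 0).
  by rewrite (symfun_coef_swap f u).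
- have [d bf] := symfun_bounded f; exists d => n.
  rewrite msizeE; apply/bigmax_leqP_seq => u uP _.
  move: uP; rewrite mcoeff_msupp mcoeff_skew_hsym_family -mcoeff_msupp.
  move/msize_mdeg_lt => lt_u; apply: leq_trans (bf n.+1).
  by apply: leq_trans lt_u; rewrite ltnS mdeg_rcons leq_addr.
Qed.

End SkewHsymFamily.

(* The adjoint of multiplication by h_a: f(x, y) = \sum_a (skew_hsym a f)(x) y^a
   for one extra variable y. *)
HB.lock Definition skew_hsym (k : fieldType) a (f : symfun k) : symfun k :=
  Symfun _ (skew_hsym_subproof a f).
Arguments skew_hsym {k} a f.

Section SkewHsym.
Variable k : fieldType.
Local Notation Lambda := (symfun k).
Implicit Types f g : Lambda.

Lemma skew_hsym_val a f : symfun_val (skew_hsym a f) = skew_hsym_family a f.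
Proof. by rewrite skew_hsym.unlock. Qed.

Lemma mcoeff_skew_hsym a f n (u : 'X_{1..n}) :
  (symfun_val (skew_hsym a f) n)@_u = (symfun_val f n.+1)@_(mnmrcons u a).
Proof. by rewrite skew_hsym_val mcoeff_muni. Qed.

Fact skew_hsym_is_linear a : linear (skew_hsym a : Lambda -> Lambda).
Proof.
move=> c f g; apply: symfun_eqP => n u.
by rewrite symfunD symfunZ mcoeffD mcoeffZ !mcoeff_skew_hsym mcoeffD mcoeffZ.
Qed.

HB.instance Definition _ a := GRing.isLinear.Build k Lambda Lambda *:%R
  (skew_hsym a) (skew_hsym_is_linear a).

Lemma skew_hsym0 f : skew_hsym 0 f = f.
Proof.
by apply: symfun_eqP => n u; rewrite mcoeff_skew_hsym symfun_coef_rcons0.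
Qed.

(** Comparison of the coefficients of y^a in f(x, y) g(x, y). *)
Lemma skew_hsymM a f g :
  skew_hsym a (f * g) = \sum_(i < a.+1) skew_hsym i f * skew_hsym (a - i) g.
Proof.
apply: symfun_inj => n; rewrite symfun_sum skew_hsym_val.
rewrite /skew_hsym_family symfunM muniM coefM.
by apply: eq_bigr => i _; rewrite symfunM !skew_hsym_val.
Qed.

Lemma skew_hsym_hsym a b :
  skew_hsym a (hsym k b) = if (a <= b)%N then hsym k (b - a) else 0.
Proof.
apply: symfun_eqP => n u; rewrite mcoeff_skew_hsym mcoeff_hsym mdeg_rcons.
case: leqP => [ab|ba]; last first.
  by rewrite symfun0 mcoeff0 gtn_eqF // (leq_trans ba) ?leq_addl.
by rewrite mcoeff_hsym -[in RHS](eqn_add2r a) subnK.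
Qed.

Lemma mcoeff_psum r n (u : 'X_{1..n}) :
  (symfun_val (psum k r.+1) n)@_u = \sum_(i < n) (u == U_(i) *+ r.+1)%MM%:R.
Proof.
rewrite /= raddf_sum; apply: eq_bigr => i _.
by rewrite /= mpolyXn mcoeffX eq_sym.
Qed.

End SkewHsym.

(** * Double sums over the triangle i + j <= n *)

Lemma exchange_sum_triangle (V : nmodType) n (F : nat -> nat -> V) :
  \sum_(i < n.+1) \sum_(j < (n - i).+1) F i j =
  \sum_(j < n.+1) \sum_(i < (n - j).+1) F i j.
Proof.
under eq_bigr => i _ do rewrite (big_ord_widen n.+1) ?ltnS ?leq_subr //.
rewrite (exchange_big_dep predT) //=; apply: eq_bigr => j _.
rewrite [RHS](big_ord_widen n.+1 (F^~ j)) ?ltnS ?leq_subr //.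
by apply: eq_bigl => i; have := ltn_ord i; have := ltn_ord j; lia.
Qed.

Lemma sum_triangle_diag (V : nmodType) n (F : nat -> nat -> V) :
  \sum_(i < n.+1) \sum_(j < (n - i).+1) F i (i + j)%N =
  \sum_(m < n.+1) \sum_(i < m.+1) F i m.
Proof.
transitivity (\sum_(m < n.+1) \sum_(i < n.+1 | (i < m.+1)%N) F i m); last first.
  by apply: eq_bigr => m _; rewrite (big_ord_widen n.+1 (F^~ m)).
rewrite (exchange_big_dep predT) //=; apply: eq_bigr => i _.
rewrite -(big_geq_mkord _ _ predT (F i)) -[X in \sum_(X <= _ < _) _]add0n.
rewrite big_addn big_mkord.
rewrite subSn -1?ltnS //; apply: eq_bigr => j _; by rewrite addnC.
Qed.

(** * Adjoints of multiplication by the p_n *)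

Section SkewHsymPsum.
Variable k : fieldType.
Local Notation Lambda := (symfun k).
Implicit Types f g : Lambda.

(** p_(s+1)(x, y) = p_(s+1)(x) + y^(s+1), so y^(s+1) is the only positive power of y that occurs. *)
Lemma skew_hsym_psum a s :
  skew_hsym a.+1 (psum k s.+1) = (a == s)%:R.
Proof.
apply: symfun_eqP => n u; rewrite mcoeff_skew_hsym mcoeff_psum big_ord_recr /=.
rewrite big1 ?add0r => [|i _]; last first.
  case: eqP => // /(congr1 (fun v : 'X_{1..n.+1} => v ord_max)).
  rewrite mnmrcons_max mulmnE mnm1E.
  by rewrite (_ : _ == ord_max = false) // -val_eqE /= ltn_eqF.
transitivity ((a == s)%:R * (u == 0%MM)%:R : k); last first.
  case: eqP => _; rewrite ?mul0r ?mul1r ?symfun0 ?mcoeff0 //.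
  by rewrite symfun1 mcoeff1.
rewrite -natrM mulnb; congr (nat_of_bool _)%:R.
rewrite eq_sym eq_mnmrcons mulmnE mnm1E eqxx mul1n eqSS andbC eq_sym.
congr (_ && _); rewrite eq_sym; congr (u == _); apply/mnmP => i.
by rewrite mnmE mulmnE mnm1E mnm0E -val_eqE /= gtn_eqF.
Qed.

(** Newton's identity solved for its term with index n. The recursive calls are at all i < n, hence
    the fuel; any fuel above n gives the same value. *)
Fixpoint skew_psum_rec fuel n f : Lambda :=
  if fuel is m.+1 then
    skew_hsym n f *+ n - \sum_(i < n) skew_psum_rec m i (skew_hsym (n - i) f)
  else 0.

End SkewHsymPsum.

(* The adjoint of multiplication by p_n, obtained from the adjoints of
   multiplication by the h_n through Newton's identity. *)
HB.lock Definition skew_psum (k : fieldType) n (f : symfun k) : symfun k :=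
  skew_psum_rec n.+1 n f.
Arguments skew_psum {k} n f.

Section SkewPsum.
Variable k : fieldType.
Local Notation Lambda := (symfun k).
Implicit Types f g : Lambda.

Lemma skew_psum_recE m n f : (n < m)%N -> skew_psum_rec m n f = skew_psum n f.
Proof.
rewrite skew_psum.unlock => nm.
have rec_fuel m' : (n < m')%N -> skew_psum_rec m n f = skew_psum_rec m' n f.
  elim: m m' n nm f => [//|m IHm] [//|m'] n nm f nm' /=; congr (_ - _).
  by apply: eq_bigr => i _; apply: IHm; apply: leq_trans (ltn_ord i) _.
exact: rec_fuel.
Qed.

Lemma skew_psumE n f :
  skew_psum n f =
  skew_hsym n f *+ n - \sum_(i < n) skew_psum i (skew_hsym (n - i) f).
Proof.
rewrite {1}skew_psum.unlock /=.
by congr (_ - _); apply: eq_bigr => i _; apply: skew_psum_recE.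
Qed.

(** The adjoint of n h_n = \sum_i p_i h_(n - i). The term i = 0 vanishes by [skew_psum0]; with it
    the sums in [skew_psumM] run over full triangles. *)
Lemma skew_newton n f :
  \sum_(i < n.+1) skew_psum i (skew_hsym (n - i) f) = skew_hsym n f *+ n.
Proof.
by rewrite big_ord_recr /= subnn skew_hsym0 (skew_psumE n) addrCA subrr addr0.
Qed.

Fact skew_psum_is_linear n : linear (skew_psum n : Lambda -> Lambda).
Proof.
elim/ltn_ind: n => n IHn c f g; rewrite !(skew_psumE n) linearP /= mulrnDl.
rewrite scalerMnr scalerBr addrACA; congr (_ + _); rewrite scaler_sumr -opprD.
rewrite -big_split /=; congr (- _).
by apply: eq_bigr => i _; rewrite linearP IHn.
Qed.

HB.instance Definition _ n := GRing.isLinear.Build k Lambda Lambda *:%R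
  (skew_psum n) (skew_psum_is_linear n).

Lemma skew_psum0 f : skew_psum 0 f = 0.
Proof. by rewrite skew_psumE mulr0n big_ord0 subrr. Qed.

(** Induction on n, with d i the Leibniz defect of [skew_psum i]. The values of d i at h_j^* f and
    h_(n-i-j)^* g are summed over i + j <= n. By induction only i = n contributes, which gives the
    defect sought; by [skew_hsymM] and Newton's identity the same sum cancels. *)
Lemma skew_psumM n f g :
  skew_psum n (f * g) = skew_psum n f * g + f * skew_psum n g.
Proof.
apply/eqP; rewrite -subr_eq0; apply/eqP.
elim/ltn_ind: n f g => n IHn f g.
pose d i (x y : Lambda) :=
  skew_psum i (x * y) - (skew_psum i x * y + x * skew_psum i y).
rewrite -/(d n f g).
transitivity (\sum_(i < n.+1) \sum_(j < (n - i).+1)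
    d i (skew_hsym j f) (skew_hsym (n - i - j) g)).
  rewrite big_ord_recr /= subnn big_ord1 !skew_hsym0 big1 ?add0r // => i _.
  by rewrite big1 // => j _; apply: IHn.
under eq_bigr => i _.
  rewrite sumrB big_split /= -[X in X - _]raddf_sum -skew_hsymM.
  over.
rewrite sumrB skew_newton big_split /=.
rewrite (exchange_sum_triangle n (fun i j =>
  skew_hsym j f * skew_psum i (skew_hsym (n - i - j) g))).
under [X in _ - (_ + X)]eq_bigr => j _.
  rewrite -mulr_sumr.
  under eq_bigr => i _ do rewrite subnAC.
  rewrite skew_newton.
  over.
have -> : \sum_(i < n.+1) \sum_(j < (n - i).+1)
    skew_psum i (skew_hsym j f) * skew_hsym (n - i - j) g =
  \sum_(m < n.+1) (skew_hsym m f *+ m) * skew_hsym (n - m) g.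
  transitivity (\sum_(i < n.+1) \sum_(j < (n - i).+1)
    skew_psum i (skew_hsym (i + j - i) f) * skew_hsym (n - (i + j)) g).
    by apply: eq_bigr => i _; apply: eq_bigr => j _; rewrite addKn subnDA.
  rewrite (sum_triangle_diag n (fun i m => skew_psum i (skew_hsym (m - i) f)
     * skew_hsym (n - m) g)).
  by apply: eq_bigr => m _; rewrite -mulr_suml skew_newton.
(* The product h_j^* f times h_(n-j)^* g has multiplicity n on the left, and j + (n - j) on the
   right. *)
apply/eqP; rewrite subr_eq0 -big_split skew_hsymM -sumrMnl; apply/eqP.
apply: eq_bigr => j _ /=; rewrite mulrnAl mulrnAr -mulrnDr subnKC //.
by rewrite -ltnS.
Qed.

Lemma skew_psum1 n : skew_psum n 1 = 0 :> Lambda.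
Proof.
have /eqP := skew_psumM n 1 1.
by rewrite !mulr1 mul1r -subr_eq0 opprD addrA subrr sub0r oppr_eq0 => /eqP.
Qed.

(** In the Newton recursion every [skew_hsym] of positive index sends a power sum to a constant,
    which the operators [skew_psum i] kill; only the leading term survives. *)
Lemma skew_psum_psum r s :
  skew_psum r (psum k s.+1) = if r == s.+1 then r%:R else 0.
Proof.
rewrite skew_psumE big1 ?subr0 => [|i _]; last first.
  rewrite -(subnSK (ltn_ord i)) skew_hsym_psum.
  by case: eqP => _; rewrite ?skew_psum1 ?raddf0.
case: r => [|r]; first by rewrite mulr0n.
by rewrite skew_hsym_psum eqSS; case: eqP => // _; rewrite mul0rn.
Qed.

Lemma hsym0 : hsym k 0 = 1.
Proof.
apply: symfun_eqP => m u; rewrite mcoeff_hsym symfun1 mcoeff1 mdeg_eq0.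
by case: eqP.
Qed.

(** With the convention that h_z = 0 for z < 0, the adjoints shift the index without case
    distinctions. *)
Definition hsymz (z : int) : Lambda := if z is Posz a then hsym k a else 0.

Lemma skew_hsym_hsymz a z : skew_hsym a (hsymz z) = hsymz (z - a%:Z).
Proof.
case: z => [b|b] /=; last by rewrite raddf0; case E: (_ - _) => //=; lia.
rewrite skew_hsym_hsym; case: leqP => [ab|ba]; first by rewrite subzn.
by case E: (_ - _) => //=; lia.
Qed.

(** The leading term of the Newton recursion is r + 1 copies of h_(z-r-1); by induction each of the
    r terms with i > 0 removes one copy. *)
Lemma skew_psum_hsymz r z : skew_psum r.+1 (hsymz z) = hsymz (z - r.+1%:Z).
Proof.
elim/ltn_ind: r z => r IHr z; rewrite skew_psumE big_ord_recl skew_psum0 add0r.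
under eq_bigr => i _ do rewrite lift0 skew_hsym_hsymz IHr ?ltn_ord //.
under eq_bigr => i _.
  rewrite (_ : _ - _ - _ = z - r.+1%:Z); last by have := ltn_ord i; lia.
  over.
by rewrite sumr_const card_ord skew_hsym_hsymz mulrS addrK.
Qed.

Lemma skew_psum_prod n (I : eqType) (s : seq I) (F : I -> Lambda) : uniq s ->
  skew_psum n (\prod_(i <- s) F i) =
  \sum_(i <- s) \prod_(j <- s) (if j == i then skew_psum n (F j) else F j).
Proof.
elim: s => [_|i s IHs /= /andP[is_ us]]; first by rewrite !big_nil skew_psum1.
rewrite !big_cons skew_psumM IHs // eqxx; congr (_ * _ + _).
  apply: eq_big_seq => j js; case: eqP => // ji; by rewrite -ji js in is_.
rewrite mulr_sumr; apply: eq_big_seq => j js; rewrite big_cons.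
by case: eqP => // ij; rewrite ij js in is_.
Qed.

End SkewPsum.

(** * The functionals [pairing] and [one_pairing], and their separation property *)

Section Pairing.
Variable k : fieldType.
Local Notation Lambda := (symfun k).
Implicit Types (f g : Lambda) (l m : seq nat).

(** The constant term, i.e. the Hall inner product with 1, read off in zero variables. *)
Definition counit f : k := (symfun_val f 0)@_0%MM.

Fact counit_is_scalar : scalar counit.
Proof. by move=> c f g; rewrite /counit symfunD symfunZ mcoeffD mcoeffZ. Qed.

HB.instance Definition _ := GRing.isLinear.Build k Lambda k *%R
  counit counit_is_scalar.

Lemma mnm0P (u : 'X_{1..0}) : u = 0%MM.
Proof. by apply/mnmP => -[]. Qed.

Lemma counitM f g : counit (f * g) = counit f * counit g.
Proof.
rewrite /counit symfunM; exact: (rmorphM (mcoeff 0%MM)).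
Qed.

Lemma counit1 : counit 1 = 1.
Proof. by rewrite /counit symfun1 mcoeff1 eqxx. Qed.

Definition skew_psums l f : Lambda := foldl (fun g r => skew_psum r g) f l.

Fact skew_psums_is_linear l : linear (skew_psums l).
Proof. by elim: l => [//|r l IHl] c f g; rewrite /= linearP IHl. Qed.

HB.instance Definition _ l := GRing.isLinear.Build k Lambda Lambda *:%R
  (skew_psums l) (skew_psums_is_linear l).

(* The Hall inner product with p_l, i.e. the value of the class function
   corresponding to f on permutations of cycle type l. *)
Definition pairing l f : k := counit (skew_psums l f).

Fact pairing_is_scalar l : scalar (pairing l).
Proof. by move=> c f g; rewrite /pairing !linearP. Qed.

HB.instance Definition _ l := GRing.isLinear.Build k Lambda k *%R
  (pairing l) (pairing_is_scalar l).

Lemma pairing_cons r l f : pairing (r :: l) f = pairing l (skew_psum r f).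
Proof. by []. Qed.

Definition one_skew_psums l f : Lambda := foldl (fun g r => g + skew_psum r g) f l.

Fact one_skew_psums_is_linear l : linear (one_skew_psums l).
Proof.
elim: l => [//|r l IHl] c f g /=.
by rewrite linearP addrACA -scalerDr IHl.
Qed.

HB.instance Definition _ l := GRing.isLinear.Build k Lambda Lambda *:%R
  (one_skew_psums l) (one_skew_psums_is_linear l).

(* The inner product of f with \prod_(r <- l) (1 + p_r), i.e. with the image
   of p_l under the adjoint of multiplication by \sum_n h_n: the value of the
   class function corresponding to f * \sum_n h_n on cycle type l. *)
Definition one_pairing l f : k := counit (one_skew_psums l f).

Fact one_pairing_is_scalar l : scalar (one_pairing l).
Proof. by move=> c f g; rewrite /one_pairing !linearP. Qed.

HB.instance Definition _ l := GRing.isLinear.Build k Lambda k *%R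
  (one_pairing l) (one_pairing_is_scalar l).

Lemma one_pairing_cons r l f :
  one_pairing (r :: l) f = one_pairing l f + one_pairing l (skew_psum r f).
Proof. by rewrite /one_pairing /= linearD raddfD. Qed.

Lemma skew_hsym_comm a b f :
  skew_hsym a (skew_hsym b f) = skew_hsym b (skew_hsym a f).
Proof.
by apply: symfun_eqP => n u; rewrite !mcoeff_skew_hsym (symfun_coef_swap f u).
Qed.

Lemma skew_hsym_psum_comm a r f :
  skew_hsym a (skew_psum r f) = skew_psum r (skew_hsym a f).
Proof.
elim/ltn_ind: r f => r IHr f; rewrite !(skew_psumE r) linearB raddfMn /=.
rewrite skew_hsym_comm raddf_sum; congr (_ - _).
by apply: eq_bigr => i _; rewrite /= IHr // skew_hsym_comm.
Qed.

Lemma skew_psum_comm r s f :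
  skew_psum r (skew_psum s f) = skew_psum s (skew_psum r f).
Proof.
elim/ltn_ind: s f => s IHs f; rewrite !(skew_psumE s) linearB raddfMn /=.
rewrite skew_hsym_psum_comm raddf_sum; congr (_ - _).
by apply: eq_bigr => i _; rewrite /= IHs // skew_hsym_psum_comm.
Qed.

Lemma skew_psums_rem r l f : r \in l ->
  skew_psums l f = skew_psums (rem r l) (skew_psum r f).
Proof.
elim: l f => [//|s l IHl] f; rewrite inE /=; case: (eqVneq s r) => [-> //|_].
by move/IHl => -> /=; rewrite skew_psum_comm.
Qed.

Lemma perm_pairing l m f : perm_eq l m -> pairing l f = pairing m f.
Proof.
rewrite /pairing => lm; congr counit.
elim: l m f lm => [|r l IHl] m f lm; first by move/perm_size/esym/size0nil: lm => ->.
have rm : r \in m by rewrite -(perm_mem lm) mem_head.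
rewrite (skew_psums_rem _ rm) /=; apply: IHl.
by rewrite -(perm_cons r) (permPl lm) perm_to_rem.
Qed.

Lemma pairing_has0 l f : 0%N \in l -> pairing l f = 0.
Proof.
by move=> l0; rewrite /pairing (skew_psums_rem _ l0) skew_psum0 !linear0.
Qed.

(** The coefficient of a monomial is reached by extracting the exponents of its variables one at a
    time, from the last variable on. *)
Lemma counit_skew_hsyms_eq0 f :
  (forall s, counit (foldl (fun g a => skew_hsym a g) f s) = 0) -> f = 0.
Proof.
move=> f0; apply: symfun_eqP => n u; rewrite symfun0 mcoeff0.
elim: n f f0 u => [|n IHn] f f0 u.
  by rewrite (mnm0P u); apply: (f0 [::]).
have [v [a ->]] := mnmrconsP u; rewrite -mcoeff_skew_hsym; apply: IHn => s.
exact: (f0 (a :: s)).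
Qed.

Hypothesis char0 : [pchar k] =i pred0.

Lemma mulrn_char0 (x : k) n : x *+ n.+1 = 0 -> x = 0.
Proof.
move/eqP; rewrite -mulr_natr mulf_eq0 => /orP[/eqP //|].
by rewrite ((pcharf0P k).1 char0).
Qed.

(** Newton's identity expresses a h_a^* through the p_i^* h_(a-i)^* with i > 0. Dividing by a, the
    vanishing of all pairings passes from f to h_a^* f, and [counit_skew_hsyms_eq0] applies. *)
Lemma pairing_inj f : (forall l, pairing l f = 0) -> f = 0.
Proof.
have step a g : (forall l, pairing l g = 0) ->
    forall l, pairing l (skew_hsym a g) = 0.
  elim/ltn_ind: a g => -[|a] IHa g g0 l; first by rewrite skew_hsym0.
  apply: (@mulrn_char0 _ a); rewrite -raddfMn -skew_newton raddf_sum.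
  rewrite big_ord_recl skew_psum0 raddf0 add0r big1 // => i _.
  rewrite /= -pairing_cons; apply: IHa => //.
  by rewrite subSS ltnS leq_subr.
move=> f0; apply: counit_skew_hsyms_eq0 => s.
elim: s f f0 => [|a s IHs] f f0; first exact: (f0 [::]).
by apply: IHs => l; apply: step.
Qed.

(** The difference of [one_pairing] at r :: l and at l is its value at l on p_r^* f. So the
    assumption passes from f to p_r^* f, and iteration reaches every [pairing]. *)
Lemma one_pairing_inj f :
  (forall l, is_composition l -> one_pairing l f = 0) -> f = 0.
Proof.
move=> f0; apply: pairing_inj => m.
elim: m f f0 => [|r m IHm] f f0; first exact: (f0 [::]).
rewrite pairing_cons; apply: IHm => l lC; case: r => [|r].
  by rewrite skew_psum0 linear0.
apply: (addrI (one_pairing l f)); rewrite -one_pairing_cons addr0 f0 ?f0 //.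
Qed.

End Pairing.

(** * Degrees, and their effect on the pairings *)

Section Degrees.
Variable k : fieldType.
Local Notation Lambda := (symfun k).
Implicit Types (f g : Lambda) (l m : seq nat) (P Q : pred nat).

(** One notion for homogeneity, upper bounds and lower bounds on the degrees, the predicate being
    [pred1 d], [ltn^~ d] or [leq d]. *)
Definition degrees_in P f :=
  forall n (u : 'X_{1..n}), ~~ P (mdeg u) -> (symfun_val f n)@_u = 0.

Lemma homogeneousP d f : homogeneous d f <-> degrees_in (pred1 d) f.
Proof.
split=> [hf n u|df n]; first exact: dhomog_nemf_coeff.
apply/dhomogP => u; rewrite mcoeff_msupp; apply: contraNeq => ud.
exact/eqP/df.
Qed.

Lemma degrees_in_bounded f : exists d, degrees_in (ltn^~ d) f.
Proof.
have [d bf] := symfun_bounded f; exists d => n u; rewrite -leqNgt => du.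
apply: memN_msupp_eq0; apply: msize_mdeg_ge; exact: leq_trans (bf n) du.
Qed.

Lemma degrees_inW P Q f : degrees_in P f -> (forall d, P d -> Q d) -> degrees_in Q f.
Proof. by move=> Pf PQ n u Qu; apply: Pf; apply: contra Qu; apply: PQ. Qed.

Lemma degrees_in0 P : degrees_in P 0.
Proof. by move=> n u _; rewrite symfun0 mcoeff0. Qed.

Lemma degrees_inD P f g : degrees_in P f -> degrees_in P g -> degrees_in P (f + g).
Proof. by move=> Pf Pg n u Pu; rewrite symfunD mcoeffD Pf ?Pg ?addr0. Qed.

Lemma degrees_inZ P c f : degrees_in P f -> degrees_in P (c *: f).
Proof. by move=> Pf n u Pu; rewrite symfunZ mcoeffZ Pf ?mulr0. Qed.

Lemma degrees_in_sum P I (r : seq I) (Q : pred I) (F : I -> Lambda) :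
  (forall i, Q i -> degrees_in P (F i)) -> degrees_in P (\sum_(i <- r | Q i) F i).
Proof.
by move=> PF; elim/big_ind: _ => //; [apply: degrees_in0|apply: degrees_inD].
Qed.

Lemma degrees_in_skew_hsym a P f :
  degrees_in P f -> degrees_in (fun d => P (d + a)%N) (skew_hsym a f).
Proof.
by move=> Pf n u Pu; rewrite mcoeff_skew_hsym Pf // mdeg_rcons.
Qed.

Lemma degrees_in_skew_psum r P f :
  degrees_in P f -> degrees_in (fun d => P (d + r)%N) (skew_psum r f).
Proof.
elim/ltn_ind: r P f => r IHr P f Pf; rewrite skew_psumE.
apply: degrees_inD.
  by rewrite -scaler_nat; apply: degrees_inZ; apply: degrees_in_skew_hsym.
rewrite -scaleN1r; apply: degrees_inZ; apply: degrees_in_sum => i _.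
have := IHr _ (ltn_ord i) _ _ (degrees_in_skew_hsym (a := (r - i)%N) Pf).
move/degrees_inW; apply=> d.
by rewrite -addnA subnKC // ltnW.
Qed.

Lemma pairing_degrees P l f : degrees_in P f -> ~~ P (sumn l) -> pairing l f = 0.
Proof.
elim: l P f => [|r l IHl] P f Pf.
  by move=> P0; apply: Pf; rewrite mdeg0.
rewrite pairing_cons /= addnC => Prl.
exact: (IHl (fun d => P (d + r)%N)) (degrees_in_skew_psum Pf) Prl.
Qed.

Lemma pairing_homogeneous d l f :
  homogeneous d f -> sumn l != d -> pairing l f = 0.
Proof. by move=> /homogeneousP/pairing_degrees; apply. Qed.

(** Every term of \prod_(r in l) (1 + p_r) other than p_l has degree less than the sum of l, hence
    pairs to 0 with f. *)
Lemma one_pairingE l f : is_composition l ->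
  degrees_in (leq (sumn l)) f -> one_pairing l f = pairing l f.
Proof.
elim: l f => [//|r l IHl] f /= /andP[r0 lC] lf.
rewrite one_pairing_cons pairing_cons !IHl //; last first.
- apply: (degrees_inW lf) => d; apply: leq_trans; exact: leq_addl.
- apply: (degrees_inW (degrees_in_skew_psum (r := r) lf)) => d.
  by rewrite addnC leq_add2r.
rewrite (pairing_degrees lf) ?add0r //.
by rewrite -ltnNge -[X in (X < _)%N]add0n ltn_add2r.
Qed.

Lemma homogeneousD d f g :
  homogeneous d f -> homogeneous d g -> homogeneous d (f + g).
Proof. by move=> df dg n; rewrite symfunD; apply: dhomogD; [apply: df|apply: dg]. Qed.

Lemma homogeneousZ d c f : homogeneous d f -> homogeneous d (c *: f).
Proof. by move=> df n; rewrite symfunZ; apply: dhomogZ; apply: df. Qed.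

Lemma homogeneous0 d : homogeneous d (0 : Lambda).
Proof. by move=> n; rewrite symfun0; apply: dhomog0. Qed.

Lemma homogeneous_sum d I (r : seq I) (Q : pred I) (F : I -> Lambda) :
  (forall i, Q i -> homogeneous d (F i)) -> homogeneous d (\sum_(i <- r | Q i) F i).
Proof.
move=> dF; elim/big_ind: _ => //; [exact: homogeneous0|exact: homogeneousD].
Qed.

Lemma homogeneousM d e f g :
  homogeneous d f -> homogeneous e g -> homogeneous (d + e) (f * g).
Proof. by move=> df eg n; apply: dhomogM. Qed.

Lemma homogeneous1 : homogeneous 0 (1 : Lambda).
Proof. by move=> n; apply: dhomog1. Qed.

Lemma homogeneous_hsym a : homogeneous a (hsym k a).
Proof.
apply/homogeneousP => n u /= /negPf ua; by rewrite mcoeff_hsym ua.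
Qed.

Lemma homogeneous_prod (I : finType) (d : I -> nat) (F : I -> Lambda) :
  (forall i, homogeneous (d i) (F i)) -> homogeneous (\sum_i d i) (\prod_i F i).
Proof.
move=> dF; elim/big_rec2: _ => [|i e x _ ex]; first exact: homogeneous1.
exact: homogeneousM.
Qed.

End Degrees.

(** * The numbers z_l *)

Section Zpart.
Implicit Types l m : seq nat.

Lemma zpartE s l : uniq s -> {subset l <= s} ->
  zpart l = (\prod_(r <- s) (r ^ count_mem r l * (count_mem r l)`!))%N.
Proof.
move=> us ls; rewrite /zpart [RHS](bigID (mem l)) /= [X in (_ * X)%N]big1 ?muln1.
  rewrite -[RHS]big_filter; apply: perm_big; apply: uniq_perm.
  - exact: undup_uniq.
  - exact: filter_uniq.
  by move=> r; rewrite mem_undup mem_filter; case: (boolP (r \in l)) => // /ls ->.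
by move=> r /count_memPn ->.
Qed.

Lemma zpart_perm l m : perm_eq l m -> zpart l = zpart m.
Proof.
move=> lm; rewrite (zpartE (undup_uniq m)) => [|r]; last first.
  by rewrite mem_undup (perm_mem lm).
by apply: eq_bigr => r _; rewrite (seq.permP lm).
Qed.

(** Raising the multiplicity of r from c to c + 1 multiplies r^c c! by r (c + 1) and leaves the
    other factors unchanged. *)
Lemma zpart_cons r l : zpart (r :: l) = (r * (count_mem r l).+1 * zpart l)%N.
Proof.
have us := undup_uniq (r :: l).
have rs : r \in undup (r :: l) by rewrite mem_undup mem_head.
have srl : {subset r :: l <= undup (r :: l)} by move=> s; rewrite mem_undup.
have sl : {subset l <= undup (r :: l)}.
  by move=> s sl; apply: srl; rewrite inE sl orbT.
rewrite (zpartE us srl) (zpartE us sl) !(bigD1_seq r) //= eqxx add1n expnS factS.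
rewrite [in RHS]mulnA; congr (_ * _)%N; first by lia.
by apply: eq_bigr => s /negPf; rewrite eq_sym => ->.
Qed.

Lemma zpart_gt0 l : is_composition l -> (0 < zpart l)%N.
Proof.
elim: l => [_|r l IHl /andP[r0 lC]]; first by rewrite /zpart big_nil.
by rewrite zpart_cons !muln_gt0 r0 IHl.
Qed.

End Zpart.

(** * Power sums and complete functions as spanning families *)

Section Span.
Variable k : fieldType.
Local Notation Lambda := (symfun k).
Implicit Types (f g : Lambda) (l m s : seq nat) (P : pred nat).

Lemma psums_cons r l : psums k (r :: l) = psum k r * psums k l.
Proof. exact: big_cons. Qed.

Lemma hsyms_cons a s : hsyms k (a :: s) = hsym k a * hsyms k s.
Proof. exact: big_cons. Qed.

Lemma psums_rem r l : r \in l -> psums k l = psum k r * psums k (rem r l).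
Proof.
by move=> /perm_to_rem rl; rewrite -psums_cons; apply: perm_big.
Qed.

(** On products of power sums p_r^* is the derivation r d/dp_r. *)
Lemma skew_psum_psums r l : is_composition l ->
  skew_psum r (psums k l) = (r * count_mem r l)%:R *: psums k (rem r l).
Proof.
elim: l => [_|s l IHl /andP[s0 lC]].
  by rewrite /psums big_nil skew_psum1 muln0 scale0r.
rewrite psums_cons skew_psumM IHl //; case: s s0 => // s _.
rewrite skew_psum_psum /= !scaler_nat eq_sym; case: eqP => [<-|_] /=.
  rewrite mulr_natl mulrnAr; case: (boolP (s.+1 \in l)) => [sl|/count_memPn ->].
    by rewrite -psums_rem // -mulrnDr mulnDr muln1.
  by rewrite muln0 mulr0n addr0 addn0 muln1.
by rewrite mul0r add0r add0n psums_cons mulrnAr.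
Qed.

Lemma counit_psums l : is_composition l -> counit (psums k l) = (l == [::])%:R.
Proof.
case: l => [_|[|r] l //= _]; first by rewrite /psums big_nil counit1.
rewrite psums_cons counitM /counit mcoeff_psum big_ord0 mul0r //.
Qed.

(** Orthogonality of the power sums: p_r^* strips one part r from m, and its factor is the one in
    [zpart_cons]. *)
Lemma pairing_psums l m : is_composition m ->
  pairing l (psums k m) = if perm_eq l m then (zpart m)%:R else 0.
Proof.
elim: l m => [|r l IHl] m mC.
  rewrite /pairing /= counit_psums //; case: m {mC} => [|a m].
    by rewrite /zpart big_nil.
  by case: ifP => // /perm_size.
rewrite pairing_cons skew_psum_psums // linearZ /=.
case: (boolP (r \in m)) => [rm|rm]; last first.
  rewrite (count_memPn rm) muln0 mul0r; case: ifP => // /perm_mem/(_ r).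
  by rewrite mem_head (negPf rm).
have rmC : is_composition (rem r m).
  by apply/allP => x /mem_rem; apply: (allP mC).
have mE := perm_to_rem rm; rewrite IHl // (permPr mE) perm_cons.
case: ifP => _; last by rewrite mulr0.
rewrite -natrM (zpart_perm mE) zpart_cons; congr (_ * _ * _)%:R.
by rewrite (seq.permP mE) /= eqxx.
Qed.

(** A partition of a number less than d has fewer than d parts, all less than d; padded with zeros
    it is a d-tuple over ['I_d], and these are finitely many. *)
Lemma partitions_bounded d : exists2 L : seq (seq nat),
  uniq L & forall l, (l \in L) = is_partition l && (sumn l < d)%N.
Proof.
pose parts (t : d.-tuple 'I_d) := [seq x <- map val t | x != 0%N].
exists [seq l <- undup (codom parts) | is_partition l && (sumn l < d)%N].
  exact/filter_uniq/undup_uniq.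
move=> l; rewrite mem_filter mem_undup andb_idr // => /andP[/andP[_ lC] ld].
have small x : x \in l -> (x < d)%N.
  move=> xl; apply: leq_ltn_trans ld.
  by rewrite (perm_sumn (perm_to_rem xl)) leq_addr.
have szl : (size l <= sumn l)%N.
  elim: l lC {ld small} => //= x l IHl /andP[x0 lC].
  by rewrite -add1n leq_add ?IHl.
have d0 : (0 < d)%N by case: (d) ld.
pose s := [seq insubd (Ordinal d0) x | x <- l ++ nseq (d - size l) 0%N].
have szs : size s == d.
  by rewrite size_map size_cat size_nseq subnKC // ltnW // (leq_ltn_trans szl).
apply/codomP; exists (Tuple szs); rewrite /parts /= -map_comp.
rewrite (eq_in_map _ id _).1 ?map_id => [|x].
  rewrite filter_cat filter_nseq /= cats0; apply/esym/all_filterP.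
  by apply: sub_all lC => x; rewrite lt0n.
rewrite mem_cat mem_nseq => xP /=; rewrite val_insubd ifT //.
by case/orP: xP => [/small //|/andP[_ /eqP ->]].
Qed.

Hypothesis char0 : [pchar k] =i pred0.

Lemma zpart_neq0 l : is_composition l -> (zpart l)%:R != 0 :> k.
Proof. by move=> lC; rewrite ((pcharf0P k).1 char0) -lt0n zpart_gt0. Qed.

Lemma partition_sort l : is_composition l -> is_partition (sort geq l).
Proof.
move=> lC; rewrite /is_partition sort_sorted => [|x y]; last exact: leq_total.
by rewrite /is_composition all_sort.
Qed.

Lemma perm_partition l m : is_partition l -> is_partition m -> perm_eq l m -> l = m.
Proof.
move=> /andP[lS _] /andP[mS _]; apply: (@sorted_eq _ geq) => //.
  by move=> y x z /= xy yz; apply: leq_trans yz xy.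
by move=> x y /=; rewrite andbC => /anti_leq.
Qed.

(** The coefficient at p_l must be the pairing of f with p_l divided by z_l. The sum is finite as f
    has bounded degree, and [pairing_inj] reduces the equality to one of pairings. *)
Lemma psums_span P f : degrees_in P f -> exists L : seq (seq nat),
  exists2 c : seq nat -> k, f = \sum_(l <- L) c l *: psums k l
    & forall l, l \in L -> is_partition l && P (sumn l).
Proof.
move=> Pf; have [d df] := degrees_in_bounded f.
have [L uL memL] := partitions_bounded d.
exists [seq l <- L | P (sumn l)], (fun l => pairing l f / (zpart l)%:R).
  apply/eqP; rewrite -subr_eq0; apply/eqP; apply: (pairing_inj char0) => m.
  rewrite linearB linear_sum /=; apply/eqP; rewrite subr_eq0; apply/eqP.
  case: (boolP (is_composition m)) => [mC|]; last first.
    move=> /allPn[x xm]; rewrite -eqn0Ngt => /eqP x0; rewrite x0 in xm.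
    rewrite (pairing_has0 f xm) big1 // => l _.
    by rewrite linearZ /= (pairing_has0 _ xm) mulr0.
  set m0 := sort geq m.
  have m0P : is_partition m0 by apply: partition_sort.
  have m0C : is_composition m0 by case/andP: m0P.
  have mm0 : perm_eq m m0 by rewrite perm_sym perm_sort.
  rewrite (perm_pairing f mm0).
  under eq_bigr => l _ do rewrite linearZ /= (perm_pairing _ mm0).
  have part_l l : l \in [seq l <- L | P (sumn l)] -> is_partition l.
    by rewrite mem_filter memL => /andP[_ /andP[]].
  case: (boolP (m0 \in [seq l <- L | P (sumn l)])) => m0L.
    rewrite (bigD1_seq m0 m0L (filter_uniq _ uL)) /= pairing_psums //.
    rewrite perm_refl divfK ?zpart_neq0 //.
    rewrite big_seq_cond big1 ?addr0 // => l /andP[/part_l lP lm0].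
    rewrite pairing_psums; last by case/andP: lP.
    case: ifP => [/perm_partition lm|_]; last by rewrite mulr0.
    by rewrite (lm m0P lP) eqxx in lm0.
  rewrite big_seq big1 => [|l lL]; last first.
    have lP := part_l _ lL; rewrite pairing_psums; last by case/andP: lP.
    case: ifP => [/perm_partition lm|_]; last by rewrite mulr0.
    by rewrite (lm m0P lP) lL in m0L.
  (* A partition outside the list violates P or the degree bound, so f pairs to 0 with it. *)
  move: m0L; rewrite mem_filter memL m0P /= negb_and.
  by case/orP => [/(pairing_degrees Pf)|/(pairing_degrees df)].
by move=> l; rewrite mem_filter memL => /andP[-> /andP[->]].
Qed.

Lemma skew_psum_inj f g : counit f = counit g ->
  (forall r, skew_psum r.+1 f = skew_psum r.+1 g) -> f = g.
Proof.
move=> fg0 fg; apply/eqP; rewrite -subr_eq0; apply/eqP.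
apply: (pairing_inj char0) => -[|r l].
  by rewrite /pairing /= linearB /= fg0 subrr.
rewrite pairing_cons linearB /=; case: r => [|r].
  by rewrite !skew_psum0 subrr linear0.
by rewrite fg subrr linear0.
Qed.

Lemma counit_hsymz z : counit (hsymz k z) = (z == 0)%:R.
Proof.
case: z => [[|a]|a] //=; rewrite /counit ?symfun0 ?mcoeff0 //.
  by rewrite mcoeff_hsym mdeg0.
by rewrite mcoeff_hsym mdeg0.
Qed.

(** Newton's identity, checked on constant terms and after each p_(r+1)^*, which yields (r + 1)
    h_(z-r-1) from the power sums plus the identity at z - r - 1. Terms with index above z vanish,
    so N stays fixed while z decreases. *)
Lemma newton_hsymz N z : z <= N%:Z ->
  \sum_(i < N) psum k i.+1 * hsymz k (z - i.+1%:Z) = hsymz k z *+ `|z|%N.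
Proof.
have [b zb] : exists b : nat, z < b%:Z by exists `|z|.+1; lia.
elim/ltn_ind: b z zb => b IHb z zb zN.
case: (ltP z 0) => z0.
  rewrite big1 => [|i _]; first by case: z z0 {zb zN} => // n _; rewrite mul0rn.
  case E: (_ - _) => /=; rewrite ?mulr0 //; lia.
apply: skew_psum_inj => [|r].
  rewrite linear_sum big1 => [|i _] /=; last first.
    by rewrite counitM /counit mcoeff_psum big_ord0 mul0r.
  by rewrite raddfMn /= counit_hsymz; case: eqP => [->|_] //; rewrite mul0rn.
rewrite raddfMn /= skew_psum_hsymz linear_sum /=.
under eq_bigr => i _ do rewrite skew_psumM skew_psum_hsymz skew_psum_psum.
case: (ltP z r.+1%:Z) => zr.
  have hz0 (y : int) : y < 0 -> hsymz k y = 0 by case: y.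
  rewrite [in RHS]hz0 ?mul0rn; last by lia.
  rewrite big1 // => i _; rewrite (hz0 (_ - _ - _)) ?mulr0 ?addr0; last by lia.
  by case: eqP => [[ri]|]; rewrite ?mul0r // hz0 ?mulr0 //; lia.
have rN : (r < N)%N by lia.
rewrite big_split /= (bigD1 (Ordinal rN)) //= eqxx big1 ?addr0; last first.
  move=> i ir; case: eqP => [[ri]|]; rewrite ?mul0r //.
  by case/eqP: ir; apply: val_inj.
under eq_bigr => i _ do rewrite addrAC.
rewrite (IHb b.-1) //; try lia.
rewrite mulr_natl -mulrnDr; congr (_ *+ _); lia.
Qed.

Lemma psum_newton n : psum k n.+1 =
  hsym k n.+1 *+ n.+1 - \sum_(i < n) psum k i.+1 * hsym k (n - i).
Proof.
have := @newton_hsymz n.+1 n.+1 (lexx _); rewrite big_ord_recr /= subrr /= => <-.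
rewrite hsym0 mulr1 -addrA addrCA -[LHS]addr0; congr (_ + _).
apply/eqP; rewrite eq_sym subr_eq0; apply/eqP; apply: eq_bigr => i _.
by rewrite (_ : _ - _ = (n - i)%N%:Z) //; have := ltn_ord i; lia.
Qed.

(** Reduction to the h_s: f is expanded in power sums, which Newton's identity then eliminates. Both
    steps respect degrees, so only s with P (sumn s) occur. *)
Lemma hsyms_ind P (Q : Lambda -> Prop) : Q 0 ->
  (forall c f g, Q f -> Q g -> Q (c *: f + g)) ->
  (forall s, is_composition s -> P (sumn s) -> Q (hsyms k s)) ->
  forall f, degrees_in P f -> Q f.
Proof.
move=> Q0 QD Qh f /psums_span[L [c -> LP]].
have QN g1 g2 : Q g1 -> Q g2 -> Q (g1 - g2).
  by move=> Qg1 Qg2; rewrite addrC -scaleN1r; apply: QD.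
have Qsum (I : finType) (F : I -> Lambda) : (forall i, Q (F i)) -> Q (\sum_i F i).
  move=> QF; elim/big_ind: _ => // x y Qx Qy.
  by rewrite -[x]scale1r; apply: QD.
elim: L LP => [|l L IHL] LP; first by rewrite big_nil.
rewrite big_cons; apply: (QD); last first.
  by apply: IHL => m mL; apply: LP; rewrite inE mL orbT.
have /andP[/andP[_ lC] lP] := LP l (mem_head _ _).
(* Generalized to mixed products: Newton's identity either turns the first power sum into a complete
   function or lowers its index and moves the rest into s. *)
suff main s : is_composition s -> P (sumn s + sumn l)%N -> Q (hsyms k s * psums k l).
  by have := main [::] isT lP; rewrite /hsyms big_nil mul1r.
elim: l s lC {lP LP} => [|r l IHl] s.
  by move=> _ sC sP; rewrite /psums big_nil mulr1; apply: Qh; rewrite ?addn0 in sP.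
case/andP=> r0 lC; elim/ltn_ind: r s r0 => -[//|r] IHr s _ sC sP.
rewrite psums_cons psum_newton mulrBl mulrBr; apply: QN.
  rewrite mulrnAl mulrnAr -scaler_nat -[_ *: _]addr0; apply: (QD) => //.
  rewrite mulrA [hsyms k s * _]mulrC -hsyms_cons; apply: IHl => //=.
  by move: sP; rewrite /= addnCA addnA.
rewrite mulr_suml mulr_sumr; apply: Qsum => i.
have -> : hsyms k s * (psum k i.+1 * hsym k (r - i) * psums k l) =
    hsyms k ((r - i)%N :: s) * psums k (i.+1 :: l).
  rewrite psums_cons hsyms_cons !mulrA; congr (_ * _).
  by rewrite [LHS]mulrC mulrA.
have ri := ltn_ord i; apply: IHr => //=; first by rewrite sC subn_gt0 ri.
move: sP => /=; congr (is_true (P _)); lia.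
Qed.

End Span.

(** * Distributions of parts among boxes *)

Definition add_at (C : finType) (u : C -> nat) (r : nat) (c : C) : C -> nat :=
  fun c' => (u c' + r * (c' == c))%N.

(* The sum of F over all ways of distributing parts of sizes l among the boxes
   C, where F is evaluated at the contents of the boxes, initially u. *)
Fixpoint distribution_sum (R : nmodType) (C : finType) (l : seq nat)
    (F : (C -> nat) -> R) (u : C -> nat) : R :=
  if l is r :: l' then \sum_c distribution_sum l' F (add_at u r c) else F u.

Definition row_sums (C D : finType) (w : C * D -> nat) : C -> nat :=
  fun c => (\sum_d w (c, d))%N.

Definition col_sums (C D : finType) (w : C * D -> nat) : D -> nat :=
  fun d => (\sum_c w (c, d))%N.

Lemma row_sums_add_at (C D : finType) (w : C * D -> nat) r c d :
  row_sums (add_at w r (c, d)) = add_at (row_sums w) r c.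
Proof.
apply: funext => c'; rewrite /row_sums /add_at big_split /=; congr (_ + _)%N.
rewrite -big_distrr (bigD1 d) //= xpair_eqE eqxx andbT big1 ?addn0 // => d' dd.
by rewrite xpair_eqE (negPf dd) andbF.
Qed.

Lemma col_sums_add_at (C D : finType) (w : C * D -> nat) r c d :
  col_sums (add_at w r (c, d)) = add_at (col_sums w) r d.
Proof.
apply: funext => d'; rewrite /col_sums /add_at big_split /=; congr (_ + _)%N.
rewrite -big_distrr (bigD1 c) //= xpair_eqE eqxx andTb big1 ?addn0 // => c' cc.
by rewrite xpair_eqE (negPf cc).
Qed.

(** Choosing for each part a box of C and a box of D is choosing a cell of C x D; the two contents
    are the margins of the resulting table. *)
Lemma distribution_sumM (R : pzRingType) (C D : finType) l
    (F : (C -> nat) -> R) (G : (D -> nat) -> R) (w : C * D -> nat) :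
  distribution_sum l F (row_sums w) * distribution_sum l G (col_sums w) =
  distribution_sum l (fun w => F (row_sums w) * G (col_sums w)) w.
Proof.
elim: l w => [//|r l IHl] w /=; rewrite big_distrlr pair_bigA /=.
apply: eq_bigr => -[c d] _ /=.
by rewrite -(row_sums_add_at w r c d) -(col_sums_add_at w r c d) IHl.
Qed.

Lemma distribution_sum_sum (R : nmodType) (C : finType) l (I : Type) (r : seq I)
    (P : pred I) (F : I -> (C -> nat) -> R) u :
  distribution_sum l (fun u => \sum_(i <- r | P i) F i u) u =
  \sum_(i <- r | P i) distribution_sum l (F i) u.
Proof.
elim: l u => [//|s l IHl] u /=; rewrite exchange_big /=.
by apply: eq_bigr => c _; apply: IHl.
Qed.

Lemma eq_distribution_sum (R : nmodType) (C : finType) l (F G : (C -> nat) -> R) u :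
  (forall u, F u = G u) -> distribution_sum l F u = distribution_sum l G u.
Proof.
by move=> FG; elim: l u => [//|s l IHl] u /=; apply: eq_bigr => c _; apply: IHl.
Qed.

(** * Pairings with products of complete functions *)

Section HsymProduct.
Variable k : fieldType.
Local Notation Lambda := (symfun k).

(* The box c0 holds the parts left over by the factors h_(alpha c). *)
Definition hsyms_off (C : finType) (c0 : C) (alpha : C -> int) : Lambda :=
  \prod_(c in predC1 c0) hsymz k (alpha c).

Lemma eq_hsyms_off (C : finType) (c0 : C) (alpha beta : C -> int) :
  (forall c, c != c0 -> alpha c = beta c) -> hsyms_off c0 alpha = hsyms_off c0 beta.
Proof. by move=> ab; apply: eq_bigr => c cc0; rewrite ab. Qed.

Lemma skew_psum_hsyms_off (C : finType) (c0 : C) (alpha : C -> int) r :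
  skew_psum r.+1 (hsyms_off c0 alpha) =
  \sum_(c in predC1 c0) hsyms_off c0 (fun c' => alpha c' - (r.+1 * (c' == c))%:Z).
Proof.
rewrite /hsyms_off -[in LHS]big_enum skew_psum_prod ?enum_uniq // big_enum /=.
apply: eq_bigr => c _; rewrite [LHS]big_enum /=; apply: eq_bigr => c' _.
case: eqP => _; last by rewrite muln0 subr0.
by rewrite muln1 skew_psum_hsymz.
Qed.

Lemma counit_hsyms_off (C : finType) (c0 : C) (alpha : C -> int) :
  counit (hsyms_off c0 alpha) = [forall c in predC1 c0, alpha c == 0]%:R.
Proof.
transitivity (\prod_(c in predC1 c0) (alpha c == 0)%:R : k).
  rewrite /hsyms_off; elim/big_rec2: _ => [|c x y _ <-]; first exact: counit1.
  by rewrite counitM counit_hsymz.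
case: forall_inP => [h|h]; first by rewrite big1 // => c /h ->.
have /existsP[c] : [exists c, (c \in predC1 c0) && (alpha c != 0)].
  apply: contra_notT h => /existsPn h c cc0; have := h c; rewrite cc0 /=.
  by rewrite negbK.
by case/andP=> cc0 /negPf ac; rewrite (bigD1 c) //= ac mul0r.
Qed.

(** In 1 + p_r^* the summand 1 puts the part r into c0, while p_r^*, by the Leibniz rule, puts it
    into one of the other boxes c, lowering the index there by r. The counit at the end requires
    every index off c0 to be 0. *)
Lemma one_pairing_hsyms_off (C : finType) (c0 : C) (alpha : C -> int) l :
  is_composition l -> forall u : C -> nat,
  one_pairing l (hsyms_off c0 (fun c => alpha c - (u c)%:Z)) =
  distribution_sum l
    (fun u => [forall c in predC1 c0, (u c)%:Z == alpha c]%:R : k) u.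
Proof.
elim: l => [_ u|[//|r] l IHl lC u] /=.
  rewrite /one_pairing /= counit_hsyms_off; congr (nat_of_bool _)%:R.
  by apply: eq_forallb => c; rewrite subr_eq0 eq_sym.
rewrite one_pairing_cons skew_psum_hsyms_off [in RHS](bigD1 c0) //= -!IHl //.
congr (_ + _).
  congr one_pairing; apply: eq_hsyms_off => c /negPf cc0.
  by rewrite /add_at cc0 muln0 addn0.
rewrite linear_sum /=; apply: eq_bigr => c _; rewrite -IHl //.
congr one_pairing; apply: eq_hsyms_off => c' _.
by rewrite /add_at PoszD opprD addrA.
Qed.

Lemma hsyms_offE (a : seq nat) :
  hsyms k a = hsyms_off (ord0 : 'I_(size a).+1) (fun j => (nth 0 (0 :: a) j)%:Z).
Proof.
rewrite /hsyms /hsyms_off (big_nth 0%N) big_mkord [RHS]big_mkcond.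
rewrite big_ord_recl /= mul1r.
by apply: eq_bigr => i _.
Qed.

Lemma hsyms_matrix_partition n r c (M : 'M['I_n.+1]_(r, c)) :
  hsyms k (matrix_partition M) = \prod_i \prod_j hsym k (M i j).
Proof.
rewrite /hsyms (perm_big _ (permEl (perm_sort _ _))) /= big_filter.
rewrite big_mkcond big_allpairs_dep big_enum /=; apply: eq_bigr => i _.
rewrite big_enum /=; apply: eq_bigr => j _.
by case: (nat_of_ord _) => //=; rewrite hsym0.
Qed.

(** Since m_00 = 0 and h_0 = 1, the corner can serve as the box for the parts left over. *)
Lemma hsyms_matrix_off n r c (M : 'M['I_n.+1]_(r.+1, c.+1)) :
  M ord0 ord0 = 0%N :> nat ->
  hsyms k (matrix_partition M) =
  hsyms_off (ord0, ord0) (fun ij => (M ij.1 ij.2 : nat)%:Z).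
Proof.
move=> M0; rewrite hsyms_matrix_partition pair_bigA /= (bigD1 (ord0, ord0)) //=.
by rewrite M0 hsym0 mul1r.
Qed.

End HsymProduct.

(** * Matrices with prescribed margins *)

Section SharpMatrices.
Variables a b : seq nat.
Local Notation I := 'I_(size b).+1.
Local Notation J := 'I_(size a).+1.

Lemma sumn_ord (s : seq nat) : sumn s = (\sum_(i < size s) nth 0 s i)%N.
Proof. by rewrite sumnE (big_nth 0%N) big_mkord. Qed.

Lemma sum_split_col (m : I -> J -> nat) :
  (forall j : 'I_(size a), \sum_i m i (lift ord0 j) = nth 0 a j)%N ->
  (\sum_i \sum_j m i j = \sum_i m i ord0 + sumn a)%N.
Proof.
move=> mC; rewrite exchange_big big_ord_recl sumn_ord; congr (_ + _)%N.
by apply: eq_bigr => j _; apply: mC.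
Qed.

Lemma sum_split_row (m : I -> J -> nat) :
  (forall i : 'I_(size b), \sum_j m (lift ord0 i) j = nth 0 b i)%N ->
  (\sum_i \sum_j m i j = \sum_j m ord0 j + sumn b)%N.
Proof.
move=> mR; rewrite big_ord_recl sumn_ord; congr (_ + _)%N.
by apply: eq_bigr => j _; apply: mR.
Qed.

(** Given the other margins, the sums of row 0 and of column 0 are equivalent to the total n; this
    form is free of subtractions. *)
Lemma sharp_matricesP n (M : 'M['I_n.+1]_((size b).+1, (size a).+1)) :
  (maxn (sumn a) (sumn b) <= n)%N ->
  reflect [/\ M ord0 ord0 = 0%N :> nat,
      forall j : 'I_(size a), (\sum_i (M i (lift ord0 j) : nat) = nth 0 a j)%N,
      forall i : 'I_(size b), (\sum_j (M (lift ord0 i) j : nat) = nth 0 b i)%N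
    & (\sum_i \sum_j (M i j : nat) = n)%N] (M \in sharp_matrices n a b).
Proof.
rewrite geq_max => /andP[an bn]; rewrite inE; apply: (iffP and3P).
  move=> [/eqP M0 /forallP MC /forallP MR].
  have MC' (j : 'I_(size a)) : (\sum_i (M i (lift ord0 j) : nat) = nth 0 a j)%N.
    exact/eqP/(MC (lift ord0 j)).
  split=> // [i|]; first exact/eqP/(MR (lift ord0 i)).
  by rewrite (@sum_split_col (fun i j => M i j) MC') (eqP (MC ord0)) subnK.
move=> [M0 MC MR Mn]; split; first by rewrite M0.
  apply/forallP => j; case: (unliftP ord0 j) => [j' ->|->]; first by rewrite MC.
  have := @sum_split_col (fun i j => M i j) MC; rewrite Mn => nE.
  by rewrite [X in (X - _)%N]nE addnK.
apply/forallP => i; case: (unliftP ord0 i) => [i' ->|->]; first by rewrite MR.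
have := @sum_split_row (fun i j => M i j) MR; rewrite Mn => nE.
by rewrite [X in (X - _)%N]nE addnK.
Qed.

(** Like [has_margins], stated over the integers in the shape produced by
    [one_pairing_hsyms_off]. *)
Definition off_eq n (M : 'M['I_n.+1]_((size b).+1, (size a).+1))
    (w : I * J -> nat) :=
  [forall c in predC1 (ord0, ord0), (w c)%:Z == (M c.1 c.2 : nat)%:Z].

Definition has_margins (w : I * J -> nat) :=
  [forall i in predC1 ord0, (row_sums w i)%:Z == (nth 0%N (0%N :: b) i)%:Z]
  && [forall j in predC1 ord0, (col_sums w j)%:Z == (nth 0%N (0%N :: a) j)%:Z].

Lemma off_eqP n (M : 'M['I_n.+1]_((size b).+1, (size a).+1)) (w : I * J -> nat) :
  reflect (forall i j, (i, j) != (ord0, ord0) -> w (i, j) = M i j) (off_eq M w).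
Proof.
apply: (iffP forall_inP) => [wM i j ij|wM [i j] ij]; last by rewrite wM.
by have /eqP[] := wM (i, j) ij.
Qed.

Lemma has_marginsP (w : I * J -> nat) :
  reflect ((forall i : 'I_(size b), \sum_j w (lift ord0 i, j) = nth 0 b i)%N /\
           (forall j : 'I_(size a), \sum_i w (i, lift ord0 j) = nth 0 a j)%N)
    (has_margins w).
Proof.
apply: (iffP andP) => [[/forall_inP wR /forall_inP wC]|[wR wC]].
  split=> [i|j]; first by have /eqP[] := wR (lift ord0 i) isT.
  by have /eqP[] := wC (lift ord0 j) isT.
split; apply/forall_inP => i; case: (unliftP ord0 i) => [i' ->|->] // _.
  by rewrite /row_sums wR.
by rewrite /col_sums wC.
Qed.

Lemma off_eq_margins n (M : 'M['I_n.+1]_((size b).+1, (size a).+1)) w :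
  (maxn (sumn a) (sumn b) <= n)%N -> M \in sharp_matrices n a b -> off_eq M w ->
  has_margins w /\ (\sum_(c | c != (ord0, ord0)) w c = n)%N.
Proof.
move=> le_n /(sharp_matricesP _ le_n)[M0 MC MR Mn] /off_eqP wM; split.
  apply/has_marginsP; split=> [i|j].
    by rewrite -MR; apply: eq_bigr => j _; apply: wM.
  rewrite -MC; apply: eq_bigr => i _; apply: wM.
  by rewrite xpair_eqE andbF.
rewrite -[RHS]Mn pair_bigA /= [RHS](bigD1 (ord0, ord0)) //= M0 add0n.
by apply: eq_bigr => -[i j]; apply: wM.
Qed.

(** A table with the right margins agrees off the corner with exactly one matrix, over all n
    together: n is forced to be the sum of the entries off the corner. *)
Lemma sum_off_eq (R : pzSemiRingType) (w : I * J -> nat) :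
  \sum_(maxn (sumn a) (sumn b) <= n < (sumn a + sumn b).+1)
    \sum_(M in sharp_matrices n a b) (off_eq M w)%:R = (has_margins w)%:R :> R.
Proof.
case: (boolP (has_margins w)) => [|wN]; last first.
  rewrite big_nat big1 // => n /andP[le_n _]; rewrite big1 // => M Mn.
  case: (boolP (off_eq M w)) => // /(off_eq_margins le_n Mn)[wM _].
  by rewrite wM in wN.
move=> /has_marginsP[wR wC].
(* The matrix sought: w with its corner emptied. *)
pose m (i : I) (j : J) := if (i, j) == (ord0, ord0) then 0%N else w (i, j).
have mR (i : 'I_(size b)) : (\sum_j m (lift ord0 i) j = nth 0 b i)%N by rewrite -wR.
have mC (j : 'I_(size a)) : (\sum_i m i (lift ord0 j) = nth 0 a j)%N.
  by rewrite -wC; apply: eq_bigr => i _; rewrite /m xpair_eqE andbF.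
pose T := (\sum_i \sum_j m i j)%N.
have TE : (\sum_(c | c != (ord0, ord0)) w c = T)%N.
  rewrite /T pair_bigA /= [RHS](bigD1 (ord0, ord0)) //= {1}/m eqxx add0n.
  by apply: eq_bigr => -[i j] /negPf ij; rewrite /m ij.
have Ta := sum_split_col mC; have Tb := sum_split_row mR.
have mT i j : (m i j < T.+1)%N.
  by rewrite ltnS /T (bigD1 i) //= (bigD1 j) //= -addnA leq_addr.
(* Off the corner, row 0 lies in the columns with sums a_j; this gives the upper bound p + q on the
   total. *)
have row0 : (\sum_j m ord0 j <= sumn a)%N.
  rewrite big_ord_recl {1}/m eqxx add0n sumn_ord leq_sum // => j _.
  by rewrite -mC (bigD1 ord0) //= leq_addr.
have le_T : (maxn (sumn a) (sumn b) <= T)%N.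
  by rewrite geq_max /T {1}Ta Tb !leq_addl.
have T_le : (T < (sumn a + sumn b).+1)%N by rewrite ltnS /T Tb leq_add2r.
rewrite (bigD1_seq T) ?iota_uniq ?mem_index_iota ?le_T //=.
rewrite [X in _ + X]big_seq_cond [X in _ + X]big1 ?addr0; last first.
  move=> n /andP[]; rewrite mem_index_iota => /andP[le_n _] nT.
  rewrite big1 // => M Mn; case: (boolP (off_eq M w)) => //.
  by case/(off_eq_margins le_n Mn) => _; rewrite TE => Tn; rewrite Tn eqxx in nT.
pose M : 'M['I_T.+1]_((size b).+1, (size a).+1) := \matrix_(i, j) Ordinal (mT i j).
have ME i j : M i j = m i j :> nat by rewrite mxE.
have MT : M \in sharp_matrices T a b.
  apply/sharp_matricesP => //; split=> [|j|i|]; first by rewrite ME.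
  - by rewrite -mC; apply: eq_bigr => i _; rewrite ME.
  - by rewrite -mR; apply: eq_bigr => j _; rewrite ME.
  by apply: eq_bigr => i _; apply: eq_bigr => j _; rewrite ME.
rewrite (bigD1 M MT) /= [X in X + _](_ : _ = 1); last first.
  by rewrite (_ : off_eq M w) //; apply/off_eqP => i j /negPf ij; rewrite ME /m ij.
rewrite big1 ?addr0 // => N /andP[NT NM].
case: (boolP (off_eq N w)) => // /off_eqP wN.
have /(sharp_matricesP _ le_T)[N0 _ _ _] := NT.
case/eqP: NM; apply/matrixP => i j; apply: val_inj; rewrite /= ME /m.
by case: eqP => [[-> ->] //|/eqP ij]; rewrite wN.
Qed.

End SharpMatrices.

(** * The formula in the basis h, seen through [one_pairing] *)

Section Formula.
Variable k : fieldType.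
Local Notation Lambda := (symfun k).

Definition hsyms_sharp (a b : seq nat) : Lambda :=
  \sum_(maxn (sumn a) (sumn b) <= n < (sumn a + sumn b).+1)
    \sum_(M in sharp_matrices n a b) hsyms k (matrix_partition M).

(** The product on the right counts the distributions of l among matrix cells that satisfy
    [has_margins]. By [sum_off_eq] these are sorted by the matrix M they fill off the corner, and M
    accounts for the pairing of h_(p(M)). *)
Lemma one_pairing_hsyms_sharp a b l : is_composition l ->
  one_pairing l (hsyms_sharp a b) =
  one_pairing l (hsyms k a) * one_pairing l (hsyms k b).
Proof.
move=> lC; pose z (C : finType) (_ : C) := 0%N.
have pairE (C : finType) (c0 : C) (alpha : C -> int) :
    one_pairing l (hsyms_off k c0 alpha) = distribution_sum l
      (fun u => [forall c in predC1 c0, (u c)%:Z == alpha c]%:R) (z C).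
  rewrite -one_pairing_hsyms_off //; congr one_pairing.
  by apply: eq_hsyms_off => c _; rewrite subr0.
(* Rows are indexed by b, so its factor comes first; the empty boxes are then rewritten as margins
   of the empty table. *)
rewrite mulrC (hsyms_offE k a) (hsyms_offE k b) !pairE.
have -> : @z 'I_(size b).+1 = row_sums (@z ('I_(size b).+1 * 'I_(size a).+1)%type).
  by apply: funext => i; rewrite /row_sums big1.
have -> : @z 'I_(size a).+1 = col_sums (@z ('I_(size b).+1 * 'I_(size a).+1)%type).
  by apply: funext => i; rewrite /col_sums big1.
rewrite distribution_sumM.
transitivity (\sum_(maxn (sumn a) (sumn b) <= n < (sumn a + sumn b).+1)
    \sum_(M in sharp_matrices n a b)
    distribution_sum l (fun w => (off_eq M w)%:R : k) (@z _)).
  rewrite linear_sum; apply: eq_big_nat => n /andP[le_n _] /=.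
  rewrite linear_sum; apply: eq_bigr => M /(sharp_matricesP _ le_n)[M0 _ _ _] /=.
  by rewrite hsyms_matrix_off // pairE.
under eq_bigr => n _ do rewrite -distribution_sum_sum.
rewrite -distribution_sum_sum; apply: eq_distribution_sum => w.
by rewrite sum_off_eq -natrM mulnb.
Qed.

End Formula.

(** Separating functionals embed V into the functions on D. If the image is closed under pointwise
    products, the product pulls back to V, and its bilinearity is checked on the functionals. *)
Lemma pointwise_bilinear (k : fieldType) (V : lmodType k) (T : Type)
    (D : T -> Prop) (E : T -> {scalar V}) :
  (forall f, (forall t, D t -> E t f = 0) -> f = 0) ->
  (forall f g, exists x, forall t, D t -> E t x = E t f * E t g) ->
  exists m : {bilinear V -> V -> V},
    forall f g t, D t -> E t (m f g) = E t f * E t g.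
Proof.
move=> Einj Eex; pose m f g := projT1 (cid (Eex f g)).
have mE f g t : D t -> E t (m f g) = E t f * E t g.
  by move=> Dt; rewrite /m; case: cid => x /= ->.
have Eq f g : (forall t, D t -> E t f = E t g) -> f = g.
  move=> fg; apply/eqP; rewrite -subr_eq0; apply/eqP; apply: Einj => t Dt.
  by rewrite linearB /= fg // subrr.
have mB : bilinear_for *:%R *:%R m.
  split=> g c f f'; apply: Eq => t Dt; rewrite linearP /= !mE // linearP /=.
    by rewrite mulrDl mulrA.
  by rewrite mulrDr mulrCA.
pose M : {bilinear V -> V -> V} :=
  HB.pack m (bilinear_isBilinear.Build k V V V *:%R *:%R m mB).
by exists M.
Qed.

(** * Construction of the two products and their properties *)

Section Products.
Variable k : fieldType.
Local Notation Lambda := (symfun k).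
Hypothesis char0 : [pchar k] =i pred0.

Lemma degrees_in_all (f : Lambda) : degrees_in predT f.
Proof. by []. Qed.

(** If f is the sum of the c_l p_l, the product with g multiplies each c_l by the pairing of g with
    p_l. *)
Lemma internal_product_exists : exists star : {bilinear Lambda -> Lambda -> Lambda},
  forall f g l, pairing l (star f g) = pairing l f * pairing l g.
Proof.
have [||star starE] :=
    @pointwise_bilinear k Lambda (seq nat) (fun=> True) (fun l => @pairing k l).
- by move=> f f0; apply: (pairing_inj char0) => l; apply: f0.
- move=> f g; have [L [c -> LP]] := psums_span char0 (@degrees_in_all f).
  exists (\sum_(l <- L) (c l * pairing l g) *: psums k l) => t _ /=.
  rewrite !linear_sum mulr_suml /=; apply: eq_big_seq => l /LP /andP[/andP[_ lC] _].
  rewrite !linearZ /= pairing_psums //; case: ifP => [tl|_].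
    by rewrite (perm_pairing g tl) mulrAC.
  by rewrite !mulr0 mul0r.
by exists star => f g l; apply: starE.
Qed.

(** Closure under pointwise products is linear in each argument, so it need only be shown for h_a
    and h_b, where the matrix sum is a witness. *)
Lemma sharp_product_exists : exists sharp : {bilinear Lambda -> Lambda -> Lambda},
  forall f g l, is_composition l ->
    one_pairing l (sharp f g) = one_pairing l f * one_pairing l g.
Proof.
apply: (@pointwise_bilinear k Lambda (seq nat) is_composition
  (fun l => @one_pairing k l)); first exact: one_pairing_inj.
move=> f g; move: f (@degrees_in_all f); apply: (hsyms_ind char0).
- by exists 0 => l lC; rewrite /= !linear0 mul0r.
- move=> c f f' [x xE] [x' x'E]; exists (c *: x + x') => l lC.
  by rewrite !linearP /= xE // x'E // mulrDl mulrA.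
move=> a aC _; move: g (@degrees_in_all g); apply: (hsyms_ind char0).
- by exists 0 => l lC; rewrite /= !linear0 mulr0.
- move=> c g g' [x xE] [x' x'E]; exists (c *: x + x') => l lC.
  by rewrite !linearP /= xE // x'E // mulrDr mulrCA.
by move=> b bC _; exists (hsyms_sharp k a b) => l; apply: one_pairing_hsyms_sharp.
Qed.

(** The value 0 outside the range gives homogeneity for every n, as the subtractions in
    [sharp_matrices] truncate below it. *)
Definition sharp_component a b n : Lambda :=
  if (maxn (sumn a) (sumn b) <= n < (sumn a + sumn b).+1)%N then
    \sum_(M in sharp_matrices n a b) hsyms k (matrix_partition M)
  else 0.

Lemma homogeneous_sharp_component a b n : homogeneous n (sharp_component a b n).
Proof.
rewrite /sharp_component; case: ifP => [/andP[le_n _]|_]; last exact: homogeneous0.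
apply: homogeneous_sum => M /(sharp_matricesP _ le_n)[_ _ _ Mn].
rewrite hsyms_matrix_partition -[X in homogeneous X]Mn.
apply: homogeneous_prod => i; apply: homogeneous_prod => j.
exact: homogeneous_hsym.
Qed.

Lemma hsyms_sharpE a b : hsyms_sharp k a b =
  \sum_(maxn (sumn a) (sumn b) <= n < (sumn a + sumn b).+1) sharp_component a b n.
Proof. by apply: eq_big_nat => n n_in; rewrite /sharp_component n_in. Qed.

(** For n = p + q the sum of row 0 must be p, so row 0 exhausts the columns j > 0 and all entries
    with i, j > 0 vanish. The only matrix has a along row 0 and b along column 0. *)
Lemma sharp_component_top a b :
  sharp_component a b (sumn a + sumn b) = hsyms k a * hsyms k b.
Proof.
set N := (sumn a + sumn b)%N.
have le_N : (maxn (sumn a) (sumn b) <= N)%N by rewrite geq_max leq_addr leq_addl.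
pose e (i : 'I_(size b).+1) (j : 'I_(size a).+1) : nat :=
  if i == ord0 then nth 0%N (0%N :: a) j
  else if j == ord0 then nth 0%N (0%N :: b) i else 0%N.
have eC j : (\sum_i e i (lift ord0 j) = nth 0 a j)%N.
  by rewrite big_ord_recl big1 ?addn0.
have eR i : (\sum_j e (lift ord0 i) j = nth 0 b i)%N.
  by rewrite big_ord_recl big1 ?addn0.
have eN : (\sum_i \sum_j e i j = N)%N.
  rewrite (sum_split_row eR) /N (sumn_ord a); congr (_ + _)%N.
  by rewrite big_ord_recl add0n.
have e_lt i j : (e i j < N.+1)%N.
  by rewrite ltnS -eN (bigD1 i) //= (bigD1 j) //= -addnA leq_addr.
pose M0 : 'M['I_N.+1]_((size b).+1, (size a).+1) :=
  \matrix_(i, j) Ordinal (e_lt i j).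
have M0E i j : M0 i j = e i j :> nat by rewrite mxE.
have M0N : M0 \in sharp_matrices N a b.
  apply/sharp_matricesP => //; split=> [|j|i|]; first by rewrite M0E.
  - by rewrite -eC; apply: eq_bigr => i _; rewrite M0E.
  - by rewrite -eR; apply: eq_bigr => j _; rewrite M0E.
  by rewrite -[RHS]eN; apply: eq_bigr => i _; apply: eq_bigr => j _; rewrite M0E.
rewrite /sharp_component le_N ltnSn (big_pred1 M0) => [|M]; last first.
  apply/idP/eqP => [/(sharp_matricesP _ le_N)[M00 MC MR MN]|-> //].
  have := @sum_split_row _ _ (fun i j => M i j) MR; rewrite MN => /addIn row0.
  rewrite big_ord_recl M00 add0n sumn_ord in row0.
  have core i j : M (lift ord0 i) (lift ord0 j) = 0%N :> nat.
    have : (\sum_j \sum_i (M (lift ord0 i) (lift ord0 j) : nat) = 0)%N.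
      apply: (@addnI (\sum_j (M ord0 (lift ord0 j) : nat))%N).
      rewrite -big_split addn0 -[RHS]row0; apply: eq_bigr => j' _ /=.
      by rewrite -MC big_ord_recl.
    move/eqP; rewrite sum_nat_eq0 => /forallP/(_ j) /=; rewrite sum_nat_eq0.
    by move=> /forallP/(_ i)/eqP.
  apply/matrixP => i j; apply: val_inj; rewrite /= M0E /e.
  case: (unliftP ord0 i) => [i' ->|->] /=; case: (unliftP ord0 j) => [j' ->|->] //=.
  - by rewrite -MR big_ord_recl big1 ?addn0 // => j' _; rewrite core.
  - by rewrite -MC big_ord_recl big1 ?addn0 // => i' _; rewrite core.
rewrite hsyms_matrix_partition big_ord_recl; congr (_ * _).
  rewrite big_ord_recl M0E hsym0 mul1r /hsyms (big_nth 0%N) big_mkord.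
  by apply: eq_bigr => j _; rewrite M0E.
rewrite /hsyms (big_nth 0%N) big_mkord; apply: eq_bigr => i _.
rewrite big_ord_recl M0E big1 ?mulr1 // => j _; by rewrite M0E hsym0.
Qed.

Section Interpolation.
Variables star sharp : {bilinear Lambda -> Lambda -> Lambda}.
Hypothesis starE : forall f g l, pairing l (star f g) = pairing l f * pairing l g.
Hypothesis sharpE : forall f g l, is_composition l ->
  one_pairing l (sharp f g) = one_pairing l f * one_pairing l g.

Lemma one_pairing_eq (f g : Lambda) :
  (forall l, is_composition l -> one_pairing l f = one_pairing l g) -> f = g.
Proof.
move=> fg; apply/eqP; rewrite -subr_eq0; apply/eqP.
by apply: (one_pairing_inj char0) => l lC; rewrite linearB /= fg ?subrr.
Qed.

Lemma pairing_eq (f g : Lambda) :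
  (forall l, is_composition l -> pairing l f = pairing l g) -> f = g.
Proof.
move=> fg; apply/eqP; rewrite -subr_eq0; apply/eqP.
apply: (pairing_inj char0) => l; case: (boolP (is_composition l)) => [lC|].
  by rewrite linearB /= fg ?subrr.
by case/allPn => x xl; rewrite -eqn0Ngt => /eqP x0; rewrite pairing_has0 // -x0.
Qed.

Lemma sharpA : associative sharp.
Proof.
by move=> f g h; apply: one_pairing_eq => l lC; rewrite !sharpE // mulrA.
Qed.

Lemma sharp_hsyms a b : sharp (hsyms k a) (hsyms k b) = hsyms_sharp k a b.
Proof.
by apply: one_pairing_eq => l lC; rewrite sharpE // one_pairing_hsyms_sharp.
Qed.

(** As a class function p_l is z_l times the indicator of cycle type l, and such functions are
    multiplied pointwise. *)
Lemma star_psums : is_internal_product star.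
Proof.
move=> l m lP mP; apply: pairing_eq => t tC; rewrite starE.
have [/andP[_ lC] /andP[_ mC]] := (lP, mP); rewrite !pairing_psums //.
case: (eqVneq l m) => [<-|lm]; last first.
  rewrite linear0; case: ifP => [tl|]; last by rewrite mul0r.
  case: ifP => [tm|]; last by rewrite mulr0.
  case/eqP: lm; apply: perm_partition => //.
  by rewrite -(permPl tl).
rewrite linearZ /= pairing_psums //.
by case: ifP; rewrite ?mulr0.
Qed.

(** The existence of such components passes to linear combinations in each argument, so [hsyms_ind]
    reduces it to h_a and h_b with a of sum p and b of sum q. *)
Lemma sharp_components p q f g : homogeneous p f -> homogeneous q g ->
  exists c : nat -> Lambda,
    [/\ forall n, homogeneous n (c n),
        sharp f g = \sum_(maxn p q <= n < (p + q).+1) c n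
      & c (p + q)%N = f * g].
Proof.
move=> + /homogeneousP gq => /homogeneousP.
move: f; apply: (hsyms_ind char0).
- exists (fun=> 0); split=> [n||]; first exact: homogeneous0.
    by rewrite linear0l big1.
  by rewrite mul0r.
- move=> x f f' [c [cn cE ctop]] [c' [c'n c'E c'top]].
  exists (fun n => x *: c n + c' n); split=> [n||].
  + by apply: homogeneousD => //; apply: homogeneousZ.
  + by rewrite linearPl cE c'E scaler_sumr big_split.
  by rewrite ctop c'top mulrDl scalerAl.
move=> a aC /eqP <-; move: g gq; apply: (hsyms_ind char0).
- exists (fun=> 0); split=> [n||]; first exact: homogeneous0.
    by rewrite linear0r big1.
  by rewrite mulr0.
- move=> x f' f'' [c [cn cE ctop]] [c' [c'n c'E c'top]].
  exists (fun n => x *: c n + c' n); split=> [n||].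
  + by apply: homogeneousD => //; apply: homogeneousZ.
  + by rewrite linearPr cE c'E scaler_sumr big_split.
  by rewrite ctop c'top mulrDr scalerAr.
move=> b bC /eqP <-; exists (sharp_component a b); split.
- exact: homogeneous_sharp_component.
- by rewrite sharp_hsyms hsyms_sharpE.
exact: sharp_component_top.
Qed.

(* On cycle types of size p the two pairings agree in degrees at least p, so
   the component of degree p of f # g pairs like f * g. *)
Lemma sharp_interpolates : interpolates star sharp.
Proof.
move=> p q f g fp gq; have [c [cn cE ctop]] := sharp_components fp gq.
exists c; split=> // pq; apply: pairing_eq => l lC; rewrite starE.
rewrite -{q}pq maxnn in gq cE {ctop} *.
case: (eqVneq (sumn l) p) => [lp|lp]; last first.
  by rewrite !(@pairing_homogeneous k p) ?mul0r.
have degW n (h : Lambda) :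
    (p <= n)%N -> homogeneous n h -> degrees_in (leq (sumn l)) h.
  by rewrite lp => pn /homogeneousP/degrees_inW; apply=> e /eqP ->.
rewrite -(one_pairingE lC (degW p f _ fp)) // -(one_pairingE lC (degW p g _ gq)) //.
rewrite -sharpE // one_pairingE // cE; last first.
  by rewrite big_nat; apply: degrees_in_sum => n /andP[pn _]; apply: degW (cn n).
rewrite linear_sum (bigD1_seq p) ?iota_uniq //=; last first.
  by rewrite mem_index_iota leqnn ltnS leq_addr.
rewrite big1 ?addr0 // => n np; apply: pairing_homogeneous (cn n) _.
by rewrite lp eq_sym.
Qed.

End Interpolation.

End Products.

Theorem theorem3p1 (k : fieldType) (char0 : [pchar k] =i pred0) :
  exists star sharp : {bilinear symfun k -> symfun k -> symfun k},
    [/\ is_internal_product star,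
        associative sharp,
        interpolates star sharp
      & forall a b : seq nat, is_composition a -> is_composition b ->
          sharp (hsyms k a) (hsyms k b) =
          \sum_(maxn (sumn a) (sumn b) <= n < (sumn a + sumn b).+1)
            \sum_(M in sharp_matrices n a b) hsyms k (matrix_partition M)].
Proof.
have [star starE] := internal_product_exists char0.
have [sharp sharpE] := sharp_product_exists char0.
exists star, sharp; split.
- exact: star_psums.
- exact: sharpA.
- exact: sharp_interpolates.
- by move=> a b _ _; apply: sharp_hsyms.
Qed.
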